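(* Let $(x_*,\lambda_*,\mu_* )$ be a KKT-point of the problem $(\mathcal{P})$ satisfying the strict complementarity condition, let the functions $f$, $F$, and $g$ be twice Fréchet differentiable at $x_*$, and let $\phi$ be differentiable at zero with $\phi'(0)>0$. Suppose also that $Q(x_* )[\cdot]$ is positive definite and the second order sufficient optimality conditions hold at $x_*$. Then there exist $c_*>0$ and $\theta>0$ such that for any $c\ge c_*$ the triplet $(x_*,\lambda_*,\mu_* )$ is a point of isolated (i.e. strict) local minimum of $\mathcal{L}(\cdot,c)$ and $$\mathcal{L}(x,\lambda,\mu,c)\ge\mathcal{L}(x_*,\lambda_*,\mu_*,c)+\theta\Big(\|x-x_*\|^2+\|\lambda-\lambda_*\|^2+|\mu-\mu_*|^2\Big)$$ for any $(x,\lambda,\mu)$ in a neighbourhood of $(x_*,\lambda_*,\mu_* )$.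
   Context: Setting. $X$ and $H$ are real Hilbert spaces, $M=\{1,\dots,m\}$, and $f,g_i\colon X\to\mathbb{R}$ ($i\in M$), $F\colon X\to H$ are continuously Fréchet differentiable; $g=(g_1,\dots,g_m)$. Problem $(\mathcal{P})$: minimise $f(x)$ subject to $F(x)=0$, $g_i(x)\le 0$, $i\in M$. It is assumed that $(\mathcal{P})$ has a globally optimal solution. $|\cdot|$ is the Euclidean norm; $\max\{y,z\}$ of vectors is taken coordinatewise; $\nabla g(x)y\in\mathbb{R}^m$ is the vector with coordinates $\langle\nabla g_i(x),y\rangle$; $DF(x)[\cdot]\colon X\to H$ is the Fréchet derivative, $DF(x)^*$ its adjoint; $\mathrm{diag}(\cdot)$ is the diagonal matrix. The function $\phi\colon[0,+\infty)\to[0,+\infty]$ is convex, non-decreasing, lower semicontinuous, $\phi(t)=0$ iff $t=0$, $\mathrm{dom}\,\phi\ne\{0\}$, and either $\mathrm{dom}\,\phi=[0,+\infty)$ and $\phi(t)\to+\infty$ as $t\to\infty$, or $\mathrm{dom}\,\phi=[0,\alpha)$ for some $\alpha>0$ and $\phi(t)\to+\infty$ as $t\to\alpha$. The function $\psi\colon[0,+\infty)^m\to\mathbb{R}$ is continuously differentiable and concave, $\psi(0)>0$, $0$ is a global maximum point of $\psi$, and $\frac{\partial\psi}{\partial y_i}(y)=0$ whenever $y\in[0,+\infty)^m$, $y_i=0$. Put $b(x)=\psi(\max\{g(x),0\})$, $p(x,\mu)=b(x)/(1+|\mu|^2)$, $\Omega=\{x\in X\mid b(x)>0,\ \phi(\|F(x)\|^2)<+\infty\}$,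 $L(x,\lambda,\mu)=f(x)+\langle\lambda,F(x)\rangle+\langle\mu,g(x)\rangle$ for $\lambda\in H$, $\mu\in\mathbb{R}^m$, and $$\eta(x,\lambda,\mu)=\tfrac12\big\|DF(x)[\nabla_xL(x,\lambda,\mu)]\big\|^2+\tfrac12\sum_{i=1}^m\big(\langle\nabla g_i(x),\nabla_xL(x,\lambda,\mu)\rangle+g_i(x)^2\mu_i\big)^2.$$ For $c>0$ the augmented Lagrangian is $$\mathcal{L}(x,\lambda,\mu,c)=f(x)+\langle\lambda,F(x)\rangle+\tfrac c2(1+\|\lambda\|^2)\phi(\|F(x)\|^2)+\langle\mu,q\rangle+\tfrac{c}{2p(x,\mu)}|q|^2+\eta(x,\lambda,\mu),\quad q=\max\{g(x),-\tfrac1c p(x,\mu)\mu\},$$ if $x\in\Omega$, and $\mathcal{L}(x,\lambda,\mu,c)=+\infty$ otherwise. Also $$Q(x)[\lambda,\mu]=\tfrac12\Big\|DF(x)\Big[DF(x)^*[\lambda]+\sum_{i=1}^m\mu_i\nabla g_i(x)\Big]\Big\|^2+\tfrac12\Big|\nabla g(x)\Big(DF(x)^*[\lambda]+\sum_{i=1}^m\mu_i\nabla g_i(x)\Big)+\mathrm{diag}(g_i(x)^2)\mu\Big|^2,$$ and $Q(x)[\cdot]$ is positive definite if there is $a>0$ with $Q(x)[\lambda,\mu]\ge a(\|\lambda\|^2+|\mu|^2)$ for all $\lambda\in H,\mu\in\mathbb{R}^m$. A triplet $(x_*,\lambda_*,\mu_* )\in X\times H\times\mathbb{R}^m$ is a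 KKT-point of $(\mathcal{P})$ if $\nabla_xL(x_*,\lambda_*,\mu_* )=0$, $F(x_* )=0$, $\max\{g(x_* ),-\mu_*\}=0$. Let $M(x)=\{i\in M\mid g_i(x)=0\}$. Strict complementarity at $(x_*,\lambda_*,\mu_* )$ means $(\mu_* )_i>0$ for all $i\in M(x_* )$. The second order sufficient optimality conditions hold at $x_*$ if there exists $\rho>0$ such that $D^2_{xx}L(x_*,\lambda_*,\mu_* )[z,z]\ge\rho\|z\|^2$ for all $z\in X$ with $DF(x_* )[z]=0$ and $\langle\nabla g_i(x_* ),z\rangle=0$ for all $i\in M(x_* )$. The neighbourhood in the conclusion may depend on $c$. *)

(* Defs.v *)
From HB Require Import structures.
From mathcomp Require Import all_boot all_order all_algebra.
From mathcomp Require Import all_classical all_reals all_analysis.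
Import Order.TTheory GRing.Theory Num.Theory.
Import numFieldNormedType.Exports.

Set Implicit Arguments.
Unset Strict Implicit.
Unset Printing Implicit Defensive.

Local Open Scope classical_set_scope.
Local Open Scope ring_scope.

HB.mixin Record CompleteNormedModule_isHilbert (R : realType) X
    of CompleteNormedModule R X := {
  inner : {dot X for (@idfun R)} ;
  innerxx : forall x : X, inner x x = `|x| ^+ 2
}.

#[short(type="hilbertType")]
HB.structure Definition Hilbert (R : realType) :=
  {X of CompleteNormedModule_isHilbert R X & CompleteNormedModule R X}.

Notation "<< x , y >>" := (inner x y) (format "<< x ,  y >>") : ring_scope.

Section frechet.
Context {R : realType}.

(* [Dp] is continuous for the operator norm. *)
Definition continuously_differentiable {X W : normedModType R} (p : X -> W) :=
  (forall x, differentiable p x) /\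
  (forall x e, 0 < e ->
    \forall y \near x, forall h, `|'d p y h - 'd p x h| <= e * `|h|).

(* [B] is the derivative at [x] of the map [y |-> Dp(y)] into the bounded
   operators with the operator norm; [B h] is its value in direction [h]. *)
Definition is_d2 {X W : normedModType R} (p : X -> W) (x : X)
    (B : X -> X -> W) :=
  [/\ \forall y \near x, differentiable p y,
      (forall k, linear (B ^~ k)) /\ (forall h, linear (B h)),
      exists C, forall h k, `|B h k| <= C * `|h| * `|k|
    & forall e, 0 < e -> \forall h \near (0 : X), forall k,
        `|'d p (x + h) k - 'd p x k - B h k| <= e * `|h| * `|k|].

Definition twice_differentiable {X W : normedModType R} (p : X -> W) (x : X) :=
  exists B, is_d2 p x B.

Definition d2 {X W : normedModType R} (p : X -> W) (x : X) : X -> X -> W :=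
  xget (fun _ _ => 0) [set B | is_d2 p x B].

(* Riesz representative of a bounded linear functional. *)
Definition riesz {X : hilbertType R} (l : X -> R) : X :=
  xget 0 [set v | forall h, l h = << v, h >>].

Definition grad {X : hilbertType R} (p : X -> R) (x : X) : X := riesz ('d p x).

Definition adjoint {X H : hilbertType R} (T : X -> H) (l : H) : X :=
  riesz (fun h => << l, T h >>).

End frechet.

Section vectors.
Context {R : realType} {m : nat}.
Implicit Types u v y : 'rV[R]_m.

Definition dotv u v : R := \sum_i u 0 i * v 0 i.

(* Square of the Euclidean norm (the library norm on ['rV_m] is the sup norm). *)
Definition sqn u : R := dotv u u.

Definition maxv u v : 'rV[R]_m := \row_i Num.max (u 0 i) (v 0 i).

Definition orthant : set 'rV[R]_m := [set y | forall i, 0 <= y 0 i].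

(* Gradient relative to [A]: at boundary points of the orthant its coordinates
   are the one-sided partial derivatives. *)
Definition is_grad_within (A : set 'rV[R]_m) (psi : 'rV[R]_m -> R) y
    (d : 'rV[R]_m) :=
  forall e, 0 < e -> \forall z \near within A (nbhs y),
    `|psi z - psi y - dotv d (z - y)| <= e * `|z - y|.

Definition grad_within (A : set 'rV[R]_m) (psi : 'rV[R]_m -> R) y : 'rV[R]_m :=
  xget 0 [set d | is_grad_within A psi y d].

Definition continuously_differentiable_on (A : set 'rV[R]_m)
    (psi : 'rV[R]_m -> R) :=
  (forall y, A y -> is_grad_within A psi y (grad_within A psi y)) /\
  {within A, continuous (grad_within A psi)}.

End vectors.

Section phi_psi.
Context {R : realType}.

(* Only the values of [phi] on [0, +oo[ matter. *)
Definition dom (phi : R -> \bar R) : set R :=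
  [set t | 0 <= t /\ (phi t < +oo)%E].

Definition phi_assumptions (phi : R -> \bar R) :=
  [/\ forall t : R, 0 <= t -> (0 <= phi t)%E,
      forall s t a : R, 0 <= s -> 0 <= t -> 0 < a < 1 ->
        (phi (a * s + (1 - a) * t)%R
           <= a%:E * phi s + (1 - a)%:E * phi t)%E,
      forall s t : R, 0 <= s -> s <= t -> (phi s <= phi t)%E
    & lower_semicontinuous (phi : subspace `[(0 : R), +oo[%classic -> \bar R)] /\
  [/\ forall t : R, 0 <= t -> (phi t = 0%E <-> t = 0),
      dom phi <> [set 0]
    & (dom phi = `[0, +oo[%classic /\ phi t @[t --> +oo%R] --> +oo%E) \/
      (exists a, [/\ 0 < a, dom phi = `[0, a[%classic
                  & phi t @[t --> a^'-] --> +oo%E])].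

Definition has_right_deriv0 (phi : R -> \bar R) (d : R) :=
  (fine (phi t) - fine (phi 0)) / t @[t --> 0^'+] --> d.

Definition psi_assumptions {m : nat} (psi : 'rV[R]_m -> R) :=
  [/\ continuously_differentiable_on orthant psi,
      forall y z a, orthant y -> orthant z -> 0 <= a <= 1 ->
        a * psi y + (1 - a) * psi z <= psi (a *: y + (1 - a) *: z),
      0 < psi 0,
      forall y, orthant y -> psi y <= psi 0
    & forall y i, orthant y -> y 0 i = 0 -> grad_within orthant psi y 0 i = 0].

End phi_psi.

Section problem.
Context {R : realType} {X H : hilbertType R} {m : nat}.
Variables (f : X -> R) (F : X -> H) (g : 'I_m -> X -> R).
Implicit Types (x z : X) (l : H) (u : 'rV[R]_m).

Definition gvec x : 'rV[R]_m := \row_i g i x.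

Definition feasible : set X := [set x | F x = 0 /\ forall i, g i x <= 0].

Definition global_solution x :=
  feasible x /\ forall y, feasible y -> f x <= f y.

Definition lagrangian x l u : R := f x + << l, F x >> + dotv u (gvec x).

Definition grad_lagrangian x l u : X := grad (fun y => lagrangian y l u) x.

Definition kkt_point x l u :=
  [/\ grad_lagrangian x l u = 0, F x = 0 & maxv (gvec x) (- u) = 0].

Definition active x i := g i x = 0.

Definition strict_complementarity x u := forall i, active x i -> 0 < u 0 i.

Definition second_order_sufficient x l u :=
  exists2 rho, 0 < rho &
    forall z, 'd F x z = 0 ->
      (forall i, active x i -> << grad (g i) x, z >> = 0) ->
      rho * `|z| ^+ 2 <= d2 (fun y => lagrangian y l u) x z z.

(* The vector [∇g(x) y]. *)
Definition gradg x (y : X) : 'rV[R]_m := \row_i << grad (g i) x, y >>.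

Definition eta x l u : R :=
  2^-1 * `|'d F x (grad_lagrangian x l u)| ^+ 2 +
  2^-1 * \sum_i (<< grad (g i) x, grad_lagrangian x l u >>
                 + g i x ^+ 2 * u 0 i) ^+ 2.

Definition Q x l u : R :=
  let v := adjoint ('d F x) l + \sum_i u 0 i *: grad (g i) x in
  2^-1 * `|'d F x v| ^+ 2 +
  2^-1 * sqn (gradg x v + u *m diag_mx (\row_i g i x ^+ 2)).

Definition Q_positive_definite x :=
  exists2 a, 0 < a & forall l u, a * (`|l| ^+ 2 + sqn u) <= Q x l u.

Variables (phi : R -> \bar R) (psi : 'rV[R]_m -> R).

Definition bfun x : R := psi (maxv (gvec x) 0).

Definition pfun x u : R := bfun x / (1 + sqn u).

Definition Omega : set X :=
  [set x | 0 < bfun x /\ (phi (`|F x| ^+ 2) < +oo)%E].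

Definition aug_lagrangian x l u (c : R) : \bar R :=
  let q := maxv (gvec x) (- (c^-1 * pfun x u) *: u) in
  if `[< Omega x >] then
    ((f x + << l, F x >>)%:E
     + (c / 2 * (1 + `|l| ^+ 2))%:E * phi (`|F x| ^+ 2)
     + (dotv u q + c / (2 * pfun x u) * sqn q + eta x l u)%:E)%E
  else +oo%E.

End problem.

Definition strict_local_min {R : realType} {T : topologicalType}
    (p : T -> \bar R) (x : T) :=
  \forall y \near x, y <> x -> (p x < p y)%E.

(* Main.v *)
From HB Require Import structures.
Require Import Defs.
From mathcomp Require Import all_boot all_order all_algebra.
From mathcomp Require Import all_classical all_reals all_analysis.
From mathcomp Require Import ring lra.
Import Order.TTheory GRing.Theory Num.Theory.
Import numFieldNormedType.Exports.

(** Write [h = x - xs], [l = lam - ls], [u = mu - us].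
    - By [psi <= psi 0] and [phi t >= phi'(0) t / 2] near [0], the penalty
      coefficients are at least proportional to [c], uniformly in [x] and [mu].
      Hence, completing squares, the penalty terms of [F] and of the active
      constraints dominate the bilinear terms [<l, F x>] and [u_i g_i x] up to
      [s (|l|^2 + |u|^2)], and leave a large multiple of [|F x|^2 + sum g_i^2];
      inactive constraints cost at most [s |u|^2].
    - The remaining part [L x ls us] is bounded below by Taylor's formula.  Its
      Hessian is positive definite on the kernel of the constraint derivatives,
      hence on [X] after adding a multiple of their squared norm.  In infinite
      dimension this step needs the constraint map to be bounded below on the
      orthogonal of its kernel, which positive definiteness of [Q] gives.
    - [eta] is half the squared norm of [A_x (l, u) + b_x], where
      [|A_x (l, u)|^2 / 2] is [Q x l u] and [b_x = O(h)], so
      [eta >= a |(l, u)|^2 - small |h|^2], which absorbs the terms in [s]. *)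

Set Implicit Arguments.
Unset Strict Implicit.
Unset Printing Implicit Defensive.

Local Open Scope classical_set_scope.
Local Open Scope ring_scope.

(** * Inner products, projections and the Riesz representation *)

Section inner_product.
Context {R : realType} {X : hilbertType R}.
Implicit Types x y z : X.

Lemma innerC x y : << x, y >> = << y, x >>.
Proof. by rewrite hermC /= expr0 mul1r. Qed.

Lemma innerDl x y z : << x + y, z >> = << x, z >> + << y, z >>.
Proof. exact: linearDl. Qed.

Lemma innerZl a x z : << a *: x, z >> = a * << x, z >>.
Proof. exact: linearZl_LR. Qed.

Lemma innerDr x y z : << x, y + z >> = << x, y >> + << x, z >>.
Proof. by rewrite linearDr. Qed.

Lemma innerZr a x z : << x, a *: z >> = a * << x, z >>.
Proof. by rewrite linearZr_LR. Qed.

Lemma innerNl x z : << - x, z >> = - << x, z >>.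
Proof. exact: linearNl. Qed.

Lemma innerNr x z : << x, - z >> = - << x, z >>.
Proof. by rewrite linearNr. Qed.

Lemma inner0l x : << 0, x >> = 0.
Proof. exact: linear0l. Qed.

Lemma inner0r x : << x, 0 >> = 0.
Proof. by rewrite linear0r. Qed.

Lemma inner_suml (I : Type) (r : seq I) (P : pred I) (E : I -> X) z :
  << \sum_(i <- r | P i) E i, z >> = \sum_(i <- r | P i) << E i, z >>.
Proof. by rewrite linear_sumlz. Qed.

Lemma normD_inner x y :
  `|x + y| ^+ 2 = `|x| ^+ 2 + 2 * << x, y >> + `|y| ^+ 2.
Proof. by rewrite -!innerxx !(innerDl, innerDr) (innerC y x); ring. Qed.

Lemma normB_inner x y :
  `|x - y| ^+ 2 = `|x| ^+ 2 - 2 * << x, y >> + `|y| ^+ 2.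
Proof. by rewrite normD_inner innerNr normrN; ring. Qed.

Lemma parallelogram x y :
  `|x - y| ^+ 2 = 2 * `|x| ^+ 2 + 2 * `|y| ^+ 2 - 4 * `|2^-1 *: (x + y)| ^+ 2.
Proof.
by rewrite normrZ exprMn real_normK ?num_real // normB_inner normD_inner; field.
Qed.

Lemma cauchy_schwarz x y : `|<< x, y >>| <= `|x| * `|y|.
Proof.
have [->|x0] := eqVneq x 0; first by rewrite inner0l !normr0 mul0r.
have nx : 0 < `|x| ^+ 2 by rewrite exprn_gt0 ?normr_gt0.
rewrite -ler_sqr ?nnegrE ?mulr_ge0 // real_normK ?num_real // exprMn -(ler_pM2l nx).
rewrite -subr_ge0.
have -> : `|x| ^+ 2 * (`|x| ^+ 2 * `|y| ^+ 2) - `|x| ^+ 2 * << x, y >> ^+ 2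
   = `|(`|x| ^+ 2) *: y - << x, y >> *: x| ^+ 2.
  by rewrite normB_inner !normrZ innerZr innerZl (innerC y x) !exprMn !(real_normK, num_real); ring.
exact: sqr_ge0.
Qed.

Lemma inner_le x y : << x, y >> <= `|x| * `|y|.
Proof. exact: le_trans (ler_norm _) (cauchy_schwarz x y). Qed.

Lemma inner_inj x y : (forall z, << x, z >> = << y, z >>) -> x = y.
Proof.
move=> e; apply/eqP; rewrite -subr_eq0 -normr_eq0 -sqrf_eq0 -innerxx.
by rewrite innerDl innerNl e subrr.
Qed.

(** Taking [z = x] suffices. This turns bounds on functionals into norm bounds on their Riesz
    representatives. *)
Lemma norm_le_inner x (c : R) :
  0 <= c -> (forall z, << x, z >> <= c * `|z|) -> `|x| <= c.
Proof.
move=> c0 /(_ x); rewrite innerxx expr2.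
have [->|x0] := eqVneq x 0; first by rewrite normr0.
by rewrite ler_pM2r ?normr_gt0.
Qed.

(* The sets [{s in E | |h - s|^2 < d + e}], where [d] is the infimum, form a
   Cauchy filter base by the parallelogram identity. *)
Lemma projection_closure (E : set X) (h : X) : E 0 ->
  (forall a x y, E x -> E y -> E (a *: x + y)) ->
  exists r, closure E r /\ forall s, E s -> << h - r, s >> = 0.
Proof.
move=> E0 Elin.
pose S := [set `|h - s| ^+ 2 | s in E].
have S0 : S !=set0 by exists (`|h - 0| ^+ 2), 0.
have Slb : has_lbound S by exists 0 => _ [s _ <-]; exact: sqr_ge0.
pose d := inf S.
have dle s : E s -> d <= `|h - s| ^+ 2 by move=> Es; apply: ge_inf => //; exists s.
pose B e := [set s | E s /\ `|h - s| ^+ 2 < d + e].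
pose G := filter_from [set e : R | 0 < e] B.
have Gf : ProperFilter G.
  apply: filter_from_proper; last first.
    move=> e /= e0; have [|_ [s Es <-] hs] := @inf_adherent _ S e e0.
      by split.
    by exists s.
  apply: filter_from_filter; first by exists 1 => /=.
  move=> e1 e2 /= e10 e20; exists (Num.min e1 e2) => /=; first by rewrite lt_min e10.
  move=> s [Es hs]; split; split=> //; apply: (lt_le_trans hs);
    by rewrite lerD2l ge_min lexx ?orbT.
have Bdist e s t : B e s -> B e t -> `|s - t| ^+ 2 < 4 * e.
  move=> [Es hs] [Et ht].
  have := dle (2^-1 *: s + 2^-1 *: t).
  have -> : s - t = (h - t) - (h - s) by rewrite opprB [RHS]addrC addrA subrK.
  rewrite (parallelogram (h - t)).
  have -> : h - (2^-1 *: s + 2^-1 *: t) = 2^-1 *: ((h - t) + (h - s)).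
    have hh : 2^-1 *: (h + h) = h.
      by rewrite -mulr2n -(scaler_nat 2 h) scalerA mulVf ?pnatr_eq0 // scale1r.
    by rewrite addrACA -opprD scalerBr hh (addrC t) scalerDr.
  have Em : E (2^-1 *: s + 2^-1 *: t).
    by apply: (Elin) => //; rewrite -[_ *: t]addr0; apply: Elin.
  by move=> /(_ Em) ?; lra.
have Gc : cauchy G.
  apply/cauchy_ballP => e e0.
  exists (B (e ^+ 2 / 4), B (e ^+ 2 / 4)) => /=.
    by split; exists (e ^+ 2 / 4) => //=; rewrite divr_gt0 ?exprn_gt0.
  move=> [s t] /= [Bs Bt]; rewrite -ball_normE /=.
  rewrite -ltr_sqr ?nnegrE ?(ltW e0) //.
  by have := Bdist _ _ _ Bs Bt; rewrite mulrC divfK.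
have /cvg_ex[r Gr] : cvg G by exact: cauchy_cvg.
have Gr' : s @[s --> G] --> r by exact: Gr.
have GB e : 0 < e -> G (B e) by move=> e0; exists e.
have sq_cvg z : `|h - (s + z)| ^+ 2 @[s --> G] --> `|h - (r + z)| ^+ 2.
  apply: cvgM; apply: cvg_norm; apply: cvgB; (try exact: cvg_cst);
    apply: cvgD => //; exact: cvg_cst.
have rmax : `|h - r| ^+ 2 <= d.
  apply/ler_addgt0Pr => e e0; rewrite -[r]addr0.
  apply: (@closed_cvg _ _ _ _ _ [set x | x <= d + e] _ _ _ (sq_cvg 0)).
    exact: closed_le.
  by apply: filterS (GB _ e0) => s [_ /ltW]; rewrite addr0.
have rmin s : E s -> d <= `|h - (r + s)| ^+ 2.
  move=> Es.
  apply: (@closed_cvg _ _ _ _ _ [set x | d <= x] _ _ _ (sq_cvg s)).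
    exact: closed_ge.
  apply: filterS (GB _ ltr01) => t [Et _]; apply: dle.
  by rewrite -[t]scale1r; apply: Elin.
exists r; split.
  move=> U /Gr [e e0 BU].
  have [s Bs] := @filter_ex _ _ Gf (B e) (GB e e0).
  by exists s; split; [case: Bs|exact: BU].
move=> s Es; have [->|s0] := eqVneq s 0; first by rewrite inner0r.
have n0 : 0 < `|s| ^+ 2 by rewrite exprn_gt0 ?normr_gt0.
(* This [t] minimises [|h - r - t s|^2], with minimum [|h - r|^2 - i^2 / |s|^2]. That value is at
   least [d], while [|h - r|^2 <= d], so [i = 0]. *)
set i := << _, _ >>; pose t := i / `|s| ^+ 2.
have /rmin : E (t *: s) by rewrite -[_ *: _]addr0; apply: Elin.
rewrite opprD addrA normB_inner innerZr -/i normrZ exprMn real_normK ?num_real //.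
move=> /(le_trans rmax).
have -> : t * i = i ^+ 2 / `|s| ^+ 2 by rewrite /t; field; rewrite normr_eq0.
have -> : t ^+ 2 * `|s| ^+ 2 = i ^+ 2 / `|s| ^+ 2.
  by rewrite /t; field; rewrite normr_eq0.
move=> le; apply/eqP; rewrite -sqrf_eq0 eq_le sqr_ge0 andbT.
have : i ^+ 2 / `|s| ^+ 2 <= 0 by lra.
by rewrite pmulr_lle0 // invr_gt0.
Qed.

Lemma closure_near (E : set X) r : closure E r ->
  forall e, 0 < e -> exists2 s, E s & `|r - s| < e.
Proof.
move=> cl e e0; have [|s [Es rs]] := cl (ball r e); first exact: nbhsx_ballx.
by exists s => //; move: rs; rewrite -ball_normE.
Qed.

(** If [l z != 0], project [z] onto the closure of the kernel. Boundedness of [l] puts the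
    projection [r] in the kernel itself, so [w = z - r] is orthogonal to the kernel and has
    [l w = l z]. Since [h - (l h / l z) w] is in the kernel, a multiple of [w] represents [l]. *)
Lemma riesz_bounded (l : {linear X -> R}) (C : R) :
  (forall x, `|l x| <= C * `|x|) -> forall h, << riesz l, h >> = l h.
Proof.
move=> lC h; symmetry; move: h; rewrite /riesz.
apply: (@xgetPex _ 0 [set v | forall h, l h = << v, h >>]).
have [l0|/existsNP[z /eqP lz]] := pselect (forall h, l h = 0).
  by exists 0 => h; rewrite inner0l.
have [|a x y /= lx ly|r [clr orth]] := @projection_closure [set x | l x = 0] z.
- by rewrite /= linear0.
- by rewrite linearP lx ly scaler0 addr0.
have lr : l r = 0.
  apply/eqP; rewrite -normr_le0; apply/ler_addgt0Pr => e e0; rewrite add0r.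
  have C1 : 0 < `|C| + 1 by rewrite ltr_wpDl.
  have [s ls rs] := closure_near clr (divr_gt0 e0 C1).
  have -> : l r = l (r - s) by rewrite linearB [l s]ls subr0.
  apply: le_trans (lC _) _; rewrite ltr_pdivlMr // in rs.
  apply: le_trans (ltW rs); rewrite mulrC ler_wpM2l //.
  by apply: le_trans (ler_norm C) _; rewrite lerDl.
pose w := z - r; have lw : l w = l z by rewrite linearB lr subr0.
have w0 : `|w| != 0.
  by apply: contraNneq lz => /eqP; rewrite normr_eq0 -lw => /eqP ->; rewrite linear0.
exists ((l z / `|w| ^+ 2) *: w) => h.
have : << w, h - (l h / l z) *: w >> = 0.
  apply: orth; rewrite /= linearB linearZ /= lw.
  by rewrite -[_ *: _]/(_ * _) divfK // subrr.
rewrite innerDr innerNr innerZr innerxx innerZl => /eqP; rewrite subr_eq0 => /eqP ->.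
by field; rewrite lz normr_eq0 -normr_eq0.
Qed.

Lemma riesz_unique (l : X -> R) v : (forall h, l h = << v, h >>) -> riesz l = v.
Proof.
move=> lv; have := @xgetPex _ 0 [set v | forall h, l h = << v, h >>].
rewrite -/(riesz l) => /(_ (ex_intro _ v lv)) /= e.
by apply: inner_inj => h; rewrite -e lv.
Qed.

End inner_product.

(** * Linear functionals, gradients and adjoints *)

Section pairing.
Context {R : realType} {X : hilbertType R}.

(** A named function that can carry a linear structure and be composed with [F] in the rules of
    differentiation. *)
Definition pairing (l h : X) : R := << l, h >>.

Fact pairing_is_linear l : linear (pairing l).
Proof. by move=> a x y; rewrite /pairing innerDr innerZr. Qed.

HB.instance Definition _ l :=
  GRing.isLinear.Build R X R *:%R (pairing l) (pairing_is_linear l).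

Lemma pairing_continuous l : continuous (pairing l).
Proof.
apply/linear_bounded_continuous; rewrite /bounded_near; near=> M; near=> x => /=.
apply: le_trans (cauchy_schwarz _ _) _; apply: (@le_trans _ _ `|l|).
  rewrite ler_piMr //; near: x; exact: nbhs0_le.
by near: M; exact: nbhs_pinfty_ge.
Unshelve. all: by end_near. Qed.

End pairing.

Section derivatives.
Context {R : realType}.

Lemma diff_bounded {V W : normedModType R} (p : V -> W) x :
  differentiable p x -> exists2 C, 0 < C & forall h, `|'d p x h| <= C * `|h|.
Proof. by move=> dp; apply: linear_lipschitz; exact: diff_continuous. Qed.

Context {X H : hilbertType R}.

Lemma gradE (p : X -> R) x h : differentiable p x -> << grad p x, h >> = 'd p x h.
Proof. by case/diff_bounded => C _ pC; exact: riesz_bounded pC h. Qed.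

Lemma adjointE (T : {linear X -> H}) (C : R) l h :
  (forall x, `|T x| <= C * `|x|) -> << adjoint T l, h >> = << l, T h >>.
Proof.
move=> TC; apply: (@riesz_bounded _ _ (pairing l \o T) (`|l| * C)) => x.
by apply: le_trans (cauchy_schwarz _ _) _; rewrite -mulrA ler_wpM2l.
Qed.

Lemma diff_adjointE (p : X -> H) x l h : differentiable p x ->
  << adjoint ('d p x) l, h >> = << l, 'd p x h >>.
Proof. by case/diff_bounded => C _ pC; exact: adjointE pC. Qed.

End derivatives.

(** * First-order estimates and calculus of second derivatives *)

Section second_derivatives.
Context {R : realType} {X W : normedModType R}.
Implicit Types (p q : X -> W) (x h : X).

Lemma diff_near p x (e : R) : differentiable p x -> 0 < e ->
  \forall y \near x, `|p y - p x - 'd p x (y - x)| <= e * `|y - x|.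
Proof.
move=> dp e0; have /eqaddoP /(_ e e0) := diff_locally dp.
rewrite (near_shift 0); apply: filterS => y /=.
by rewrite !fctE /= /shift /= subr0 addrK (addrC y) opprD addrA.
Qed.

Lemma diff_lipschitz_near p x : differentiable p x ->
  exists2 K : R, 0 < K & \forall y \near x, `|p y - p x| <= K * `|y - x|.
Proof.
move=> dp; have [C C0 dC] := diff_bounded dp.
exists (1 + C); first by rewrite addr_gt0.
have := diff_near dp (@ltr01 R); apply: filterS => y py.
rewrite -[_ - p x](subrK ('d p x (y - x))) mulrDl.
by apply: le_trans (ler_normD _ _) _; rewrite lerD.
Qed.

Lemma is_d2_near p x B (e : R) : is_d2 p x B -> 0 < e ->
  \forall y \near x, differentiable p y /\
    forall k, `|'d p y k - 'd p x k - B (y - x) k| <= e * `|y - x| * `|k|.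
Proof.
case=> dp _ _ Be e0; suff : \forall y \near x, forall k,
    `|'d p y k - 'd p x k - B (y - x) k| <= e * `|y - x| * `|k|.
  by move=> Bn; apply: filterS2 dp Bn => y.
rewrite (near_shift 0); apply: filterS (Be _ e0) => h /=.
by rewrite /shift subr0 addrK (addrC h x).
Qed.

Lemma twice_differentiableD p q x :
  twice_differentiable p x -> twice_differentiable q x ->
  twice_differentiable (p \+ q) x.
Proof.
move=> [B [dp [Bl Br] [C BC] Be]] [B' [dq [Bl' Br'] [C' BC'] Be']].
have dD y : differentiable p y -> differentiable q y ->
    'd (p \+ q) y = 'd p y \+ 'd q y :> (X -> W).
  by move=> ? ?; rewrite (_ : p \+ q = p + q) // diffD.
exists (fun h k => B h k + B' h k); split.
- by apply: filterS2 dp dq => y ? ?; exact: (@differentiableD _ _ _ p q).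
- by split=> k a u v; rewrite ?(Bl, Br) ?(Bl', Br') scalerDr addrACA.
- exists (C + C') => h k; rewrite !mulrDl; apply: le_trans (ler_normD _ _) _.
  by rewrite lerD.
- move=> e e0; have e2 : 0 < e / 2 by rewrite divr_gt0.
  have dpx := nbhs_singleton dp; have dqx := nbhs_singleton dq.
  have := dp; rewrite (near_shift 0) => dp0; have := dq; rewrite (near_shift 0) => dq0.
  near=> h => k; rewrite !dD //=; first last.
  + by near: h; apply: filterS dq0 => h /=; rewrite /shift /= subr0 addrC.
  + by near: h; apply: filterS dp0 => h /=; rewrite /shift /= subr0 addrC.
  have addB (a a' c c' b b' : W) :
      a + a' - (c + c') - (b + b') = (a - c - b) + (a' - c' - b').
    by rewrite !opprD [a + a' + _]addrACA (addrACA (a - c)).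
  rewrite addB [e]splitr !mulrDl.
  apply: le_trans (ler_normD _ _) _; apply: lerD.
  + by move: k; near: h; exact: Be.
  + by move: k; near: h; exact: Be'.
Unshelve. all: by end_near. Qed.

Lemma twice_differentiable_comp {Z : normedModType R} (T : {linear W -> Z}) p x :
  continuous T -> twice_differentiable p x -> twice_differentiable (T \o p) x.
Proof.
move=> Tc [B [dp [Bl Br] [C BC] Be]].
have [M M0 TM] := linear_lipschitz Tc.
have dT y : differentiable p y -> 'd (T \o p) y = T \o 'd p y :> (X -> Z).
  by move=> dy; rewrite diff_comp // ?diff_lin //; exact: linear_differentiable.
exists (fun h k => T (B h k)); split.
- apply: filterS dp => y dy; apply: differentiable_comp => //.
  exact: linear_differentiable.
- by split=> k a u v; rewrite ?(Bl, Br) linearP.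
- exists (M * C) => h k; apply: le_trans (TM _) _.
  by rewrite -!mulrA ler_pM2l // mulrA.
- move=> e e0; have eM : 0 < e / M by rewrite divr_gt0.
  have dpx := nbhs_singleton dp.
  have := dp; rewrite (near_shift 0) => dp0.
  near=> h => k; rewrite !dT //=; last first.
    by near: h; apply: filterS dp0 => h /=; rewrite /shift /= subr0 addrC.
  rewrite -!linearB; apply: le_trans (TM _) _.
  rewrite -ler_pdivlMl // !mulrA (mulrC M^-1); move: k; near: h; exact: Be.
Unshelve. all: by end_near. Qed.

Lemma twice_differentiable_cst (a : W) x : twice_differentiable (cst a) x.
Proof.
exists (fun _ _ => 0); split.
- by apply: nearW => y; exact: differentiable_cst.
- by split=> k b u v; rewrite scaler0 addr0.
- by exists 0 => h k; rewrite normr0 !mul0r.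
- by move=> e e0; apply: nearW => h k; rewrite !diff_cst !subr0 normr0 !mulr_ge0 // ltW.
Qed.

Lemma d2P p x : twice_differentiable p x -> is_d2 p x (d2 p x).
Proof. by move=> [B pB]; apply: (@xgetPex _ _ [set B | is_d2 p x B]); exists B. Qed.

End second_derivatives.

(** * Second-order Taylor bound at a critical point *)

Section taylor.
Context {R : realType} {X : normedModType R}.

(** The mean value theorem is applied on [[0, 1]] to [p (x + t h) - t^2 B h h / 2]. Its derivative
    is the error of the linear approximation [t B h h] to ['d p (x + t h) h], which [is_d2] bounds
    by [e |h|^2]. *)
Lemma taylor2_lower (p : X -> R) x B (e : R) : is_d2 p x B ->
  (forall k, 'd p x k = 0) -> 0 < e ->
  \forall y \near x,
    p x + 2^-1 * B (y - x) (y - x) - e * `|y - x| ^+ 2 <= p y.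
Proof.
move=> pB dp0 e0; have [_ [Bl Br] _ _] := pB.
have /nbhs_ballP[r r0 ballr] := is_d2_near pB e0.
apply/nbhs_ballP; exists r => // y; rewrite -ball_normE /= distrC => yr.
set h := y - x.
have pt (t : R) : t \in `[0, 1] -> differentiable p (x + t *: h) /\
    - (e * `|h| ^+ 2) <= 'd p (x + t *: h) h - t * B h h.
  rewrite in_itv /= => /andP[t0 t1].
  have nt : `|t *: h| <= `|h| by rewrite normrZ ger0_norm // ler_piMl.
  have [|d bnd] := ballr (x + t *: h).
    by rewrite -ball_normE /= opprD addNKr normrN (le_lt_trans nt).
  split=> //; move: (bnd h).
  have -> : x + t *: h - x = t *: h by rewrite addrC addKr.
  rewrite dp0 subr0; have -> : B (t *: h) h = t * B h h.
    have := Bl h t h 0; rewrite addr0 => ->.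
    by have := Bl h (-1) 0 0; rewrite scaler0 addr0 scaleN1r addNr => ->; rewrite addr0.
  rewrite ler_norml => /andP[+ _]; apply: le_trans.
  by rewrite lerN2 -mulrA ler_pM2l // expr2 ler_wpM2r.
pose q t := p (x + t *: h) - t ^+ 2 * (2^-1 * B h h).
have dq (t : R) : t \in `[0, 1] -> is_derive t 1 q ('d p (x + t *: h) h - t * B h h).
  move=> /pt[dp _].
  have d1 : is_diff t (fun t : R => x + t *: h) (fun t => t *: h).
    apply: (is_diff_eq (is_diffD (is_diff_cst x t) (is_diff_scalel t h))).
    by apply/funext => s; rewrite !fctE add0r.
  have d2 : is_diff t (p \o (fun t : R => x + t *: h)) _ :=
    is_diff_comp d1 (differentiableP dp).
  have d3 : is_derive t 1 (p \o (fun t : R => x + t *: h)) ('d p (x + t *: h) h).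
    apply: DeriveDef; first exact: diff_derivable.
    by rewrite deriveE // diff_val /= scale1r.
  have d4 : is_derive t (1 : R) ((2^-1 * B h h) \*: (@id R) ^+ 2) (t * B h h).
    apply: is_derive_eq; rewrite expr1 /GRing.scale /= mulr1 -mulr_natl.
    by field.
  suff -> : q = (p \o (fun t : R => x + t *: h)) - ((2^-1 * B h h) \*: (@id R) ^+ 2).
    exact: is_deriveB.
  by apply/funext => s; rewrite /q !fctE /= mulrC.
have qc : {within `[0, 1], continuous q}.
  by apply: derivable_within_continuous => t /dq[].
have [t /subset_itv_oo_cc ti] := MVT ltr01 (fun t ti => dq t (subset_itv_oo_cc ti)) qc.
have [_] := pt t ti; rewrite /q !scale0r !scale1r expr0n expr1n subr0 mulr1.
have -> : x + h = y by rewrite addrC subrK.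
rewrite !mul1r mul0r subr0 addr0 => le1 e1.
by move: le1; rewrite -e1; lra.
Qed.
End taylor.

(** * From coercivity on a kernel to coercivity with a penalty *)

Section coercivity.
Context {R : realType} {X H : hilbertType R} {m : nat}.
Variables (T : {linear X -> H}) (w : 'I_m -> X) (P : pred 'I_m).

(** Squared norm of the constraint map sending [h] to [T h] and the numbers [<< w i, h >>] with
    [P i]. At the KKT-point, its zeros are the directions tested by the second order condition. *)
Definition constraint_sqnorm (h : X) : R :=
  `|T h| ^+ 2 + \sum_(i | P i) << w i, h >> ^+ 2.

Local Notation N := constraint_sqnorm.

Lemma constraint_sqnorm_eq0 h :
  N h = 0 -> T h = 0 /\ forall i, P i -> << w i, h >> = 0.
Proof.
move/eqP; rewrite paddr_eq0 ?sqr_ge0 ?sumr_ge0 // => [/andP[]|i _]; last exact: sqr_ge0.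
rewrite sqrf_eq0 normr_eq0 => /eqP -> /eqP s0; split=> // i Pi; apply/eqP.
rewrite -sqrf_eq0; apply/eqP; move: i Pi; apply: psumr_eq0P => // i _.
exact: sqr_ge0.
Qed.

Lemma constraint_sqnorm_subk h k : T k = 0 ->
  (forall i, P i -> << w i, k >> = 0) -> N (h - k) = N h.
Proof.
move=> Tk wk; rewrite /N linearB Tk subr0; congr (_ + _); apply: eq_bigr => i Pi.
by rewrite innerDr innerNr wk // subr0.
Qed.

Hypothesis Tc : continuous T.

Lemma constraint_sqnorm_continuous : continuous N.
Proof.
move=> x; apply: cvgD.
  by apply: cvgM; apply: cvg_norm; exact: Tc.
apply: cvg_big => [|i _]; first by move=> ?; exact: add_continuous.
by apply: cvgM; exact: pairing_continuous.
Qed.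

Variables (C k : R).
Hypotheses (TC : forall h, `|T h| <= C * `|h|) (k0 : 0 < k).
Hypothesis adj_coercive : forall l (u : 'I_m -> R),
  k * (`|l| ^+ 2 + \sum_(i | P i) u i ^+ 2)
    <= `|adjoint T l + \sum_(i | P i) u i *: w i| ^+ 2.

Let G z : X := adjoint T (T z) + \sum_(i | P i) << w i, z >> *: w i.

Let GE z y : << G z, y >> =
  << T z, T y >> + \sum_(i | P i) << w i, z >> * << w i, y >>.
Proof.
rewrite innerDl (adjointE _ _ TC) inner_suml; congr (_ + _).
by apply: eq_bigr => i _; rewrite innerZl.
Qed.

Let Glin a x y : a *: G x + G y = G (a *: x + y).
Proof.
apply: inner_inj => z; rewrite innerDl innerZl !GE linearP innerDl innerZl.
rewrite mulrDr mulr_sumr addrACA -big_split /=; congr (_ + _).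
by apply: eq_bigr => i _; rewrite innerDr innerZr mulrDl mulrA.
Qed.

(* [G] is [S S^*] for [S] the adjoint of the constraint map, so the coercivity of
   [S] makes the constraint map bounded below on the range of [G]. *)
Let G_bounded_below z : k * `|G z| ^+ 2 <= N (G z).
Proof.
have c1 := adj_coercive (T z) (fun i => << w i, z >>).
rewrite -/(G z) -/(N z) in c1.
have e : `|G z| ^+ 2 =
    << T z, T (G z) >> + \sum_(i | P i) << w i, z >> * << w i, G z >>.
  by rewrite -innerxx GE.
(* Young's inequality is used with weights [k / 2] and [j = 1 / (2 k)]. By [c1] the term
   [k / 2 * N z] is then at most half of [|G z|^2] and is absorbed on the left. *)
have [j j0 jk] : exists2 j, 0 <= j & j * k = 2^-1.
  by exists (2^-1 / k); rewrite ?divfK ?lt0r_neq0 // divr_ge0 ?ltW.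
have young (a b : R) : a * b <= k / 2 * a ^+ 2 + j * b ^+ 2.
  rewrite -subr_ge0 (_ : _ - _ = j * (k * a - b) ^+ 2); first by rewrite mulr_ge0 ?sqr_ge0.
  transitivity ((j * k) * k * a ^+ 2 - 2 * (j * k) * a * b + j * b ^+ 2); last by ring.
  by rewrite jk; field.
have c2 : `|G z| ^+ 2 <= k / 2 * N z + j * N (G z).
  rewrite e /N (mulrDr (k / 2)) (mulrDr j) addrACA; apply: lerD.
    by apply: le_trans (inner_le _ _) _; exact: young.
  by rewrite !mulr_sumr -big_split /=; apply: ler_sum => i _; exact: young.
have c3 : 2^-1 * `|G z| ^+ 2 <= j * N (G z) by lra.
by have := ler_wpM2l (ltW k0) c3; rewrite [k * (j * _)]mulrA (mulrC k j) jk; lra.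
Qed.

(** Let [r] be the projection of [h] onto the closure of the range of [G]. The residual [z = h - r]
    is orthogonal to [G z], so [N z = << G z, z >> = 0]. The bound of [G_bounded_below] passes to
    [r] by continuity of [N], and [N r = N h]. *)
Lemma kernel_decomposition h : exists z,
  [/\ T z = 0, forall i, P i -> << w i, z >> = 0
    & k * `|h - z| ^+ 2 <= N h].
Proof.
have [|a x y [x' _ <-] [y' _ <-]|r [clr orth]] := @projection_closure _ _ (range G) h.
- by exists 0 => //; have := Glin (-1) 0 0; rewrite scaleN1r addNr scaler0 addr0 => <-.
- by exists (a *: x' + y') => //; rewrite Glin.
have [Tz wz] : T (h - r) = 0 /\ forall i, P i -> << w i, h - r >> = 0.
  apply: constraint_sqnorm_eq0; have := orth _ (ex_intro2 _ _ (h - r) I erefl).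
  by rewrite innerC GE innerxx.
exists (h - r); split=> //.
have hr : h - (h - r) = r by rewrite opprB addrC subrK.
rewrite -(constraint_sqnorm_subk h Tz wz) hr.
have cl : closed [set y | 0 <= N y - k * `|y| ^+ 2].
  apply: (preimage_closed (f := fun y => N y - k * `|y| ^+ 2) _ (@closed_ge _ 0)).
  move=> y _; apply: cvgB; first exact: constraint_sqnorm_continuous.
  by apply: cvgM; [exact: cvg_cst|apply: cvgM; exact: cvg_norm].
rewrite -subr_ge0; suff /(_ r clr) : closure (range G) `<=` [set y | 0 <= N y - k * `|y| ^+ 2].
  by [].
rewrite [X in _ `<=` X](closure_id _).1 //; apply: closureS => _ [z _ <-] /=.
by rewrite subr_ge0; exact: G_bounded_below.
Qed.

(** A Hilbert space form of Finsler's lemma. With [h = z + r] as in [kernel_decomposition], half of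
    [rho |z|^2] absorbs the cross terms, and every multiple of [|r|^2] is paid for by [N h]. *)
Lemma positive_definite_penalized (B : X -> X -> R) (rho M : R) :
  (forall h, linear (B^~ h)) -> (forall h, linear (B h)) ->
  (forall h y, `|B h y| <= M * `|h| * `|y|) -> 0 < rho ->
  (forall z, T z = 0 -> (forall i, P i -> << w i, z >> = 0) ->
     rho * `|z| ^+ 2 <= B z z) ->
  exists2 D, 0 < D & forall h, rho / 4 * `|h| ^+ 2 - D * N h <= B h h.
Proof.
move=> Bl Br BM rho0 Bpd.
(* The three summands are the costs in [|r|^2] of splitting [|h|^2], of the cross terms and of
   [B r r]. *)
pose S := rho / 2 + 2 * M ^+ 2 / rho + `|M|.
have S0 : 0 < S.
  rewrite ltr_wpDr // ltr_wpDr ?divr_gt0 //.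
  by rewrite divr_ge0 ?(ltW rho0) // mulr_ge0 ?sqr_ge0.
exists (S / k) => [|h]; first exact: divr_gt0.
have [z [Tz wz]] := kernel_decomposition h; set r := h - z => kr.
have hE : h = z + r by rewrite addrC subrK.
have BD u v y : B (u + v) y = B u y + B v y.
  by have := Bl y 1 u v; rewrite !scale1r.
have BDr u v y : B y (u + v) = B y u + B y v.
  by have := Br y 1 u v; rewrite !scale1r.
have le1 : S * `|r| ^+ 2 <= S / k * N h.
  by rewrite mulrAC -mulrA ler_pM2l // ler_pdivlMr // mulrC.
have le2 := Bpd z Tz wz.
have := BM z r; rewrite ler_norml => /andP[le3 _].
have := BM r z; rewrite ler_norml => /andP[le4 _].
have := BM r r; rewrite ler_norml => /andP[le5 _].
have le6 : M * `|r| * `|r| <= `|M| * `|r| ^+ 2.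
  by rewrite expr2 mulrA ler_wpM2r // ler_wpM2r // ler_norm.
have le7 : `|h| ^+ 2 <= 2 * `|z| ^+ 2 + 2 * `|r| ^+ 2.
  have := parallelogram z (- r); rewrite opprK -hE normrN => ->.
  by rewrite lerBlDr lerDl mulr_ge0 ?sqr_ge0.
have le8 : 2 * M * `|z| * `|r| <= rho / 2 * `|z| ^+ 2 + 2 * M ^+ 2 / rho * `|r| ^+ 2.
  rewrite -subr_ge0 (_ : _ - _ = 2^-1 / rho * (rho * `|z| - 2 * M * `|r|) ^+ 2).
    by rewrite mulr_ge0 ?sqr_ge0 // divr_ge0 // ltW.
  by field; rewrite lt0r_neq0.
have -> : B h h = B z z + B z r + B r z + B r r by rewrite hE BD !BDr; ring.
have le9 : rho / 4 * `|h| ^+ 2 <= rho / 4 * (2 * `|z| ^+ 2 + 2 * `|r| ^+ 2).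
  by rewrite ler_pM2l // divr_gt0.
have SE : S * `|r| ^+ 2 = rho / 2 * `|r| ^+ 2 + 2 * M ^+ 2 / rho * `|r| ^+ 2
    + `|M| * `|r| ^+ 2 by rewrite /S !mulrDl.
rewrite SE in le1; lra.
Qed.
End coercivity.

(** * Sums of derivatives and perturbation of squares *)

Lemma is_diff_sum {R : realType} {X W : normedModType R} (I : Type)
    (s : seq I) (p dp : I -> X -> W) x :
  (forall i, is_diff x (p i) (dp i)) ->
  is_diff x (\sum_(i <- s) p i) (\sum_(i <- s) dp i).
Proof.
move=> pd; elim: s => [|i s IHs]; first by rewrite !big_nil; exact: is_diff_cst.
by rewrite !big_cons; exact: is_diffD.
Qed.

(** After the triangle inequality, [(1 + t)] times the gap is at least the square of
    [|a + b| - t |b|]. A small [t] makes the loss in [b] small while keeping a positive share of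
    [|a|^2]. *)
Lemma normD_sq_lower {R : realType} (V : normedModType R) (a b : V) (t : R) :
  0 < t -> t / (1 + t) * `|a| ^+ 2 - t * `|b| ^+ 2 <= `|b + a| ^+ 2.
Proof.
rewrite [b + a]addrC => t0; have t1 : 0 < 1 + t by rewrite addr_gt0.
have le1 : `|a| ^+ 2 <= (`|a + b| + `|b|) ^+ 2.
  rewrite ler_sqr ?nnegrE ?addr_ge0 //.
  by rewrite -{1}(addrK b a) (le_trans (ler_normB _ _)).
rewrite -(ler_pM2l t1); apply: (@le_trans _ _
  (t * (`|a + b| + `|b|) ^+ 2 - (1 + t) * (t * `|b| ^+ 2))).
  rewrite mulrBr lerD2r (_ : _ * (_ * _) = t * `|a| ^+ 2) ?ler_pM2l //.
  by field; rewrite lt0r_neq0.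
rewrite -subr_ge0 (_ : _ - _ = (`|a + b| - t * `|b|) ^+ 2) ?sqr_ge0 //.
by ring.
Qed.

Lemma norm_sq_perturb {R : realType} (V : normedModType R) (a b : V) (d : R) :
  `|b - a| <= d -> `|b| ^+ 2 <= 2 * `|a| ^+ 2 + 2 * d ^+ 2.
Proof.
move=> bad; have le : `|b| <= d + `|a|.
  by rewrite -{1}(subrK a b) (le_trans (ler_normD _ _)) // lerD2r.
have d0 : 0 <= d by apply: le_trans bad.
apply: (@le_trans _ _ ((d + `|a|) ^+ 2)); first by rewrite ler_sqr ?nnegrE ?addr_ge0.
by rewrite -subr_ge0 (_ : _ - _ = (d - `|a|) ^+ 2) ?sqr_ge0 //; ring.
Qed.

Lemma inner_sub_split {R : realType} {X : hilbertType R} (p q v w : X) (a b t : R) :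
  << q, v >> + a * t - (<< p, w >> + b * t) =
  - << p - q, w >> - << q, w - v >> + (a - b) * t.
Proof.
rewrite innerDl innerNl innerDr innerNr.
move: << p, w >> << q, w >> << q, v >> => ? ? ?; ring.
Qed.

(** * The gradient of the Lagrangian, [Q] and [eta] *)

Section lagrangian_derivatives.
Context {R : realType} {X H : hilbertType R} {m : nat}.
Variables (f : X -> R) (F : X -> H) (g : 'I_m -> X -> R).
Implicit Types (x z h : X) (l : H) (u : 'rV[R]_m).

Lemma lagrangianE l u : (fun x => lagrangian f F g x l u) =
  f \+ (pairing l \o F \+ \sum_i (u 0 i \*: (g i : X -> R^o))).
Proof.
apply/funext => x; rewrite /lagrangian /= -addrA; congr (_ + (_ + _)).
by rewrite fct_sumE; apply: eq_bigr => i _; rewrite mxE.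
Qed.

(** The part of the gradient of the Lagrangian that is linear in the multipliers: the adjoint of the
    derivative of the pair of [F] and [g], at [(l, u)]. *)
Definition multiplier_grad x l u : X :=
  adjoint ('d F x) l + \sum_i u 0 i *: grad (g i) x.

Section at_point.
Variable x : X.
Hypotheses (df : differentiable f x) (dF : differentiable F x)
  (dg : forall i, differentiable (g i) x).

Lemma multiplier_gradE l u h : << multiplier_grad x l u, h >> =
  << l, 'd F x h >> + \sum_i u 0 i * << grad (g i) x, h >>.
Proof.
rewrite innerDl diff_adjointE // inner_suml; congr (_ + _).
by apply: eq_bigr => i _; rewrite innerZl.
Qed.

Lemma multiplier_gradD l l' u u' : multiplier_grad x (l + l') (u + u') =
  multiplier_grad x l u + multiplier_grad x l' u'.
Proof.
apply: inner_inj => h; rewrite innerDl !multiplier_gradE innerDl addrACA -big_split.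
by congr (_ + _); apply: eq_bigr => i _; rewrite mxE mulrDl.
Qed.

Lemma is_diff_lagrangian l u : is_diff x (fun y => lagrangian f F g y l u)
  (fun h => << grad f x + multiplier_grad x l u, h >>).
Proof.
have d1 : is_diff x (pairing l \o F) (pairing l \o 'd F x).
  apply: is_diff_comp; first exact: differentiableP.
  apply: DiffDef; first by apply: linear_differentiable; exact: pairing_continuous.
  by rewrite diff_lin //; exact: pairing_continuous.
have d2 i : is_diff x (u 0 i \*: (g i : X -> R^o)) (u 0 i \*: 'd (g i : X -> R^o) x).
  by apply: is_diffZ; exact: differentiableP.
have d3 := is_diff_sum (index_enum 'I_m) d2.
rewrite lagrangianE.
have d4 := is_diffD (differentiableP df) (is_diffD d1 d3).
apply: (is_diff_eq d4); apply/funext => h; rewrite !fctE fct_sumE.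
rewrite innerDl gradE // multiplier_gradE /= /pairing; congr (_ + (_ + _)).
by apply: eq_bigr => i _; rewrite gradE.
Qed.

Lemma grad_lagrangianE l u :
  grad_lagrangian f F g x l u = grad f x + multiplier_grad x l u.
Proof.
by apply: riesz_unique => h; have [_ ->] := is_diff_lagrangian l u.
Qed.

Lemma diff_lagrangianE l u h : 'd (fun y => lagrangian f F g y l u) x h =
  << grad_lagrangian f F g x l u, h >>.
Proof. by rewrite grad_lagrangianE; have [_ ->] := is_diff_lagrangian l u. Qed.

Lemma grad_lagrangianB l l' u u' : grad_lagrangian f F g x l u =
  grad_lagrangian f F g x l' u' + multiplier_grad x (l - l') (u - u').
Proof.
by rewrite !grad_lagrangianE -addrA -multiplier_gradD !(addrC _ (_ - _)) !subrK.
Qed.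

End at_point.

Lemma twice_differentiable_lagrangian x l u : twice_differentiable f x ->
  twice_differentiable F x -> (forall i, twice_differentiable (g i) x) ->
  twice_differentiable (fun y => lagrangian f F g y l u) x.
Proof.
move=> d2f d2F d2g; rewrite lagrangianE.
have d1 : twice_differentiable (pairing l \o F) x.
  exact: (twice_differentiable_comp (@pairing_continuous _ _ l) d2F).
apply: (twice_differentiableD d2f); apply: (twice_differentiableD d1).
apply: (big_ind (fun p : X -> R^o => twice_differentiable p x)).
- exact: twice_differentiable_cst.
- move=> p q; exact: twice_differentiableD.
- move=> i _.
  have sc : continuous ( *:%R (u 0 i) : {linear R^o -> R^o}).
    exact: scaler_continuous.
  have h := twice_differentiable_comp sc (d2g i).
  exact: h.
Qed.

(** In this shape [Q] is [eta] with the gradient of the Lagrangian replaced by its part linear in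
    the multipliers. *)
Lemma QE x l u : Q F g x l u =
  2^-1 * `|'d F x (multiplier_grad x l u)| ^+ 2 +
  2^-1 * \sum_i (<< grad (g i) x, multiplier_grad x l u >>
                 + g i x ^+ 2 * u 0 i) ^+ 2.
Proof.
rewrite /Q /sqn /dotv; congr (_ + _ * _); apply: eq_bigr => i _.
by rewrite mul_mx_diag !mxE -expr2 mulrC [X in _ + X]mulrC.
Qed.

(** The vector whose squared norm is [2 eta] is affine in the multipliers, and its linear part has
    squared norm [2 Q]. So [normD_sq_lower] applies to each component. *)
Lemma eta_lower x l l' u u' (t : R) : differentiable f x ->
  differentiable F x -> (forall i, differentiable (g i) x) -> 0 < t ->
  t / (1 + t) * Q F g x (l - l') (u - u') - t * eta f F g x l' u'
    <= eta f F g x l u.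
Proof.
move=> df dF dg t0; rewrite QE /eta (grad_lagrangianB df dF dg l l' u u').
set V := multiplier_grad _ _ _; set L := grad_lagrangian _ _ _ _ _ _.
rewrite [in X in _ <= X]linearD.
set s1 := \sum_i (_ + _ * (u - u') 0 i) ^+ 2.
set s2 := \sum_i (<< _, L >> + _) ^+ 2; set s3 := \sum_i (_ + _ * u 0 i) ^+ 2.
have le1 := normD_sq_lower ('d F x V) ('d F x L) t0.
have le2 : t / (1 + t) * s1 - t * s2 <= s3.
  rewrite /s1 /s2 /s3 !mulr_sumr -sumrB; apply: ler_sum => i _.
  rewrite innerDr [u 0 i](_ : _ = (u - u') 0 i + u' 0 i); last by rewrite !mxE subrK.
  have := normD_sq_lower (<< grad (g i) x, V >> + g i x ^+ 2 * (u - u') 0 i : R^o)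
    (<< grad (g i) x, L >> + g i x ^+ 2 * u' 0 i) t0.
  rewrite !real_normK ?num_real // => /le_trans; apply; rewrite le_eqVlt; apply/orP; left.
  by apply/eqP; congr (_ ^+ 2); ring.
move: le1 le2; set r := t / (1 + t) => le1 le2; lra.
Qed.

End lagrangian_derivatives.

(** * Stability of the coercivity of [Q] near the reference point *)

Section perturbation.
Context {R : realType} {X H : hilbertType R} {m : nat}.
Variables (F : X -> H) (g : 'I_m -> X -> R) (xs : X).
Hypotheses (F_C1 : continuously_differentiable F)
  (g_C1 : forall i, continuously_differentiable (g i)).
Implicit Types (l : H) (u : 'rV[R]_m).

Lemma grad_near (p : X -> R) (e : R) : continuously_differentiable p -> 0 < e ->
  \forall x \near xs, `|grad p x - grad p xs| <= e.
Proof.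
move=> [dp pe] e0; apply: filterS (pe xs e e0) => x le.
apply: norm_le_inner; first exact: ltW.
move=> z; rewrite innerDl innerNl !gradE //.
exact: le_trans (ler_norm _) (le z).
Qed.

Lemma multiplier_grad_near (e : R) : 0 < e -> \forall x \near xs,
  forall l u n, `|l| <= n -> (forall i, `|u 0 i| <= n) ->
  `|multiplier_grad F g x l u - multiplier_grad F g xs l u| <= e * n.
Proof.
(* [F] and the [m] functions [g i] each contribute an error of at most [e' n]. *)
move=> e0; pose e' := e / (1 + m%:R).
have m0 : 0 < 1 + m%:R :> R by rewrite ltr_pwDl.
have e'0 : 0 < e' by rewrite divr_gt0.
have [dF Fe] := F_C1; have dg i := (g_C1 i).1.
have Fn := Fe xs e' e'0.
have gn : \forall x \near xs, forall i, `|grad (g i) x - grad (g i) xs| <= e'.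
  by apply: filter_forall => i; exact: grad_near.
apply: filterS2 Fn gn => x Fx gx l u n ln un.
have n0 : 0 <= n by apply: le_trans ln.
apply: norm_le_inner => [|z]; first by rewrite mulr_ge0 // ltW.
rewrite innerDl innerNl !multiplier_gradE //.
rewrite opprD addrACA -sumrB -linearB /=.
rewrite (_ : e = e' + e' *+ m); last first.
  by rewrite -mulr_natr -[e' in X in X + _]mulr1 -mulrDr divfK // lt0r_neq0.
rewrite !mulrDl; apply: lerD.
  apply: le_trans (inner_le _ _) _; rewrite [e' * n]mulrC -mulrA.
  exact: ler_pM.
rewrite mulrnAl mulrnAl -[X in _ *+ X]card_ord -sumr_const.
apply: ler_sum => i _; rewrite -mulrBr -innerNl -innerDl.
apply: le_trans (ler_norm _) _; rewrite normrM [e' * n]mulrC -mulrA.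
apply: ler_pM => //; apply: le_trans (cauchy_schwarz _ _) _.
by rewrite ler_wpM2r.
Qed.

Lemma multiplier_grad_bounded (C : R) l u n : differentiable F xs ->
  (forall i, differentiable (g i) xs) ->
  (forall h, `|'d F xs h| <= C * `|h|) -> 0 <= C ->
  `|l| <= n -> (forall i, `|u 0 i| <= n) ->
  `|multiplier_grad F g xs l u| <= (C + \sum_i `|grad (g i) xs|) * n.
Proof.
move=> dF dg FC C0 ln un; have n0 : 0 <= n by apply: le_trans ln.
apply: norm_le_inner => [|z].
  by rewrite mulr_ge0 // addr_ge0 // sumr_ge0.
rewrite multiplier_gradE // !mulrDl; apply: lerD.
  apply: le_trans (inner_le _ _) _; rewrite [C * n]mulrC -mulrA.
  exact: ler_pM.
rewrite !mulr_suml; apply: ler_sum => i _.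
apply: le_trans (ler_norm _) _; rewrite normrM [_ * n]mulrC -mulrA.
by apply: ler_pM => //; exact: cauchy_schwarz.
Qed.

(** Each of the [1 + m] components of the vector behind [Q] moves by at most [e K n], where [n] is
    the norm of [(l, u)]. Hence [Q] at [xs] is at most twice [Q] at [x] plus [a / 2 * n^2], which
    leaves the constant [a / 4]. *)
Lemma Q_coercive_near : Q_positive_definite F g xs ->
  exists2 a, 0 < a & \forall x \near xs,
    forall l u, a * (`|l| ^+ 2 + sqn u) <= Q F g x l u.
Proof.
move=> [a a0 Qa]; exists (a / 4); first by rewrite divr_gt0.
have [dF Fe] := F_C1; have dg i := (g_C1 i).1.
have [C C0 FC] := diff_bounded (dF xs).
pose M := C + \sum_i `|grad (g i) xs|.
have M0 : 0 < M by rewrite ltr_pwDl // sumr_ge0.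
pose K := 2 * M + 2; have K0 : 0 < K by rewrite addr_gt0 // mulr_gt0.
have m0 : 0 < 1 + m%:R :> R by rewrite ltr_pwDl.
(* The bound 1 gives [e^2 <= e] and [|W| <= (M + 1) n]; the other makes the total squared error at
   most [a / 2 * n^2]. *)
pose e := Num.min 1 (a / (2 * (1 + m%:R) * K ^+ 2)).
have e0 : 0 < e by rewrite lt_min ltr01 divr_gt0 // !mulr_gt0 // exprn_gt0.
have e1 : e <= 1 by rewrite ge_min lexx.
have eK : (1 + m%:R) * (e * K) ^+ 2 <= a / 2.
  apply: (@le_trans _ _ ((1 + m%:R) * (e * K ^+ 2))).
    rewrite ler_pM2l // exprMn ler_pM2r ?exprn_gt0 // expr2 ler_piMr //; exact: ltW.
  rewrite (_ : a / 2 = (1 + m%:R) * (a / (2 * (1 + m%:R) * K ^+ 2) * K ^+ 2)).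
    by rewrite ler_pM2l // ler_pM2r ?exprn_gt0 // ge_min lexx orbT.
  by field; rewrite !lt0r_neq0.
have gn : \forall x \near xs, forall i, `|grad (g i) x - grad (g i) xs| <= e.
  by apply: filter_forall => i; exact: grad_near.
have g2n : \forall x \near xs, forall i, `|g i xs ^+ 2 - g i x ^+ 2| <= e.
  apply: filter_forall => i.
  have gc : g i x @[x --> xs] --> g i xs by exact: differentiable_continuous.
  have : g i x ^+ 2 @[x --> xs] --> g i xs ^+ 2 by apply: cvgM.
  by move=> /cvgrPdist_le /(_ e e0).
have Vnear := multiplier_grad_near e0; have Fnear := Fe xs e e0.
near=> x.
have Vn : forall l u n, `|l| <= n -> (forall i, `|u 0 i| <= n) ->
    `|multiplier_grad F g x l u - multiplier_grad F g xs l u| <= e * n by near: x.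
have Fx h : `|'d F x h - 'd F xs h| <= e * `|h| by move: h; near: x.
have gx i : `|grad (g i) x - grad (g i) xs| <= e by move: i; near: x.
have g2x i : `|g i xs ^+ 2 - g i x ^+ 2| <= e by move: i; near: x.
move=> l u; set S := _ + sqn u.
have sqn0 : 0 <= sqn u by apply: sumr_ge0 => i _; rewrite -expr2 sqr_ge0.
have S0 : 0 <= S by rewrite addr_ge0 ?sqr_ge0.
pose n := Num.sqrt S; have n0 : 0 <= n by exact: sqrtr_ge0.
have n2 : n ^+ 2 = S by rewrite sqr_sqrtr.
have ln : `|l| <= n.
  by rewrite -ler_sqr ?nnegrE // n2 lerDl.
have un i : `|u 0 i| <= n.
  rewrite -ler_sqr ?nnegrE // n2 real_normK ?num_real // /S /sqn /dotv.
  rewrite (bigD1 i) //= -expr2 addrCA lerDl addr_ge0 ?sqr_ge0 // sumr_ge0 // => j _.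
  by rewrite -expr2 sqr_ge0.
have Vb := multiplier_grad_bounded (dF xs) (fun i => dg i xs) FC (ltW C0) ln un.
rewrite -/M in Vb.
move: Vb (Vn l u n ln un) => {Vn}.
move EV : (multiplier_grad F g xs l u) => V; move EW : (multiplier_grad F g x l u) => W.
move=> Vb Vn.
have Wb : `|W| <= (M + 1) * n.
  rewrite -(subrK V W); apply: le_trans (ler_normD _ _) _.
  rewrite mulrDl addrC mul1r; apply: lerD => //.
  by apply: le_trans Vn _; rewrite ler_piMl.
have en0 : 0 <= e * n by rewrite mulr_ge0 // ltW.
have CM : C <= M by rewrite lerDl sumr_ge0.
have GM i : `|grad (g i) xs| <= M.
  rewrite /M (bigD1 i) //= addrCA lerDl addr_ge0 ?(ltW C0) // sumr_ge0 //.
have d1 : `|'d F xs V - 'd F x W| <= e * K * n.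
  have -> : 'd F xs V - 'd F x W = ('d F xs W - 'd F x W) - 'd F xs (W - V).
    rewrite (linearB ('d F xs) W V) opprB.
    by rewrite [RHS]addrC addrA subrK.
  apply: le_trans (ler_normB _ _) _.
  rewrite distrC (_ : e * K * n = e * ((M + 1) * n) + (M + 1) * (e * n)); last first.
    by rewrite /K; ring.
  apply: lerD.
    by apply: le_trans (Fx W) _; rewrite ler_pM2l.
  apply: le_trans (FC _) _; apply: ler_pM => //; first exact: ltW.
  by apply: le_trans CM _; rewrite lerDl.
have d2 i : `|(<< grad (g i) xs, V >> + g i xs ^+ 2 * u 0 i : R^o)
    - (<< grad (g i) x, W >> + g i x ^+ 2 * u 0 i)| <= e * K * n.
  have -> : << grad (g i) xs, V >> + g i xs ^+ 2 * u 0 i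
    - (<< grad (g i) x, W >> + g i x ^+ 2 * u 0 i) =
      - << grad (g i) x - grad (g i) xs, W >> - << grad (g i) xs, W - V >>
      + (g i xs ^+ 2 - g i x ^+ 2) * u 0 i.
    exact: inner_sub_split.
  apply: le_trans (ler_normD _ _) _.
  rewrite (_ : e * K * n = (e * ((M + 1) * n) + M * (e * n)) + e * n); last first.
    by rewrite /K; ring.
  apply: lerD; last first.
    by rewrite normrM; apply: ler_pM.
  apply: le_trans (ler_normB _ _) _; rewrite normrN; apply: lerD.
    by apply: le_trans (cauchy_schwarz _ _) _; apply: ler_pM.
  by apply: le_trans (cauchy_schwarz _ _) _; apply: ler_pM.
have s1 := norm_sq_perturb d1.
have s2 : \sum_i (<< grad (g i) xs, V >> + g i xs ^+ 2 * u 0 i) ^+ 2 <=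
    2 * \sum_i (<< grad (g i) x, W >> + g i x ^+ 2 * u 0 i) ^+ 2
    + m%:R * (2 * (e * K * n) ^+ 2).
  rewrite (_ : m%:R * _ = \sum_(i < m) 2 * (e * K * n) ^+ 2); last first.
    by rewrite sumr_const card_ord mulr_natl.
  rewrite mulr_sumr -big_split /=.
  apply: ler_sum => i _; have := norm_sq_perturb (d2 i).
  by rewrite !real_normK ?num_real.
have := Qa l u; rewrite !QE EV EW -/S => le1.
have le2 : (1 + m%:R) * (e * K * n) ^+ 2 <= a / 2 * S.
  by rewrite exprMn n2 mulrA ler_wpM2r.
lra.
Unshelve. all: by end_near. Qed.
End perturbation.

(** * Local estimates at the KKT-point *)

Section at_kkt_point.
Context {R : realType} {X H : hilbertType R} {m : nat}.
Variables (f : X -> R) (F : X -> H) (g : 'I_m -> X -> R).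
Variables (xs : X) (ls : H) (us : 'rV[R]_m).
Hypotheses (f_C1 : continuously_differentiable f)
  (F_C1 : continuously_differentiable F)
  (g_C1 : forall i, continuously_differentiable (g i)).
Hypothesis kkt : kkt_point f F g xs ls us.
Hypotheses (f_D2 : twice_differentiable f xs) (F_D2 : twice_differentiable F xs)
  (g_D2 : forall i, twice_differentiable (g i) xs).

Let df : forall x, differentiable f x := f_C1.1.
Let dF : forall x, differentiable F x := F_C1.1.
Let dg i : forall x, differentiable (g i) x := (g_C1 i).1.
Let L x := lagrangian f F g x ls us.

Lemma kkt_sign i : g i xs <= 0 /\ 0 <= us 0 i.
Proof.
have [_ _ /rowP/(_ i)] := kkt; rewrite !mxE => e.
have := ge_max 0 (g i xs) (- us 0 i); rewrite e lexx oppr_le0.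
by move=> /esym/andP[].
Qed.

Lemma kkt_inactive i : g i xs != 0 -> us 0 i = 0.
Proof.
have [gi ui] := kkt_sign i; have [_ _ /rowP/(_ i)] := kkt; rewrite !mxE.
rewrite /Num.max; case: ifP => _ e g0; first by apply/eqP; rewrite -oppr_eq0 e.
by rewrite e eqxx in g0.
Qed.

Lemma kkt_complementarity i : us 0 i * g i xs = 0.
Proof.
by have [->|/kkt_inactive ->] := eqVneq (g i xs) 0; rewrite ?mulr0 ?mul0r.
Qed.

Lemma lagrangian_kkt : L xs = f xs.
Proof.
have [_ F0 _] := kkt; rewrite /L /lagrangian F0 inner0r addr0 /dotv big1 ?addr0 // => i _.
by rewrite mxE kkt_complementarity.
Qed.

Let L_D2 : is_d2 L xs (d2 L xs).
Proof. by apply: d2P; exact: twice_differentiable_lagrangian. Qed.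

Let dL0 k : 'd L xs k = 0.
Proof.
have [g0 _ _] := kkt.
by rewrite diff_lagrangianE // g0 inner0l.
Qed.

Lemma lagrangian_taylor (e : R) : 0 < e -> \forall x \near xs,
  f xs + 2^-1 * d2 L xs (x - xs) (x - xs) - e * `|x - xs| ^+ 2 <= L x.
Proof.
by move=> e0; rewrite -lagrangian_kkt; apply: taylor2_lower.
Qed.

(** The gradient vanishes at [xs], and its variation from there is linear up to a small error
    because the Lagrangian is twice differentiable. *)
Lemma grad_lagrangian_near : exists2 K : R, 0 < K &
  \forall x \near xs, `|grad_lagrangian f F g x ls us| <= K * `|x - xs|.
Proof.
have [_ _ [C BC] _] := L_D2; exists (1 + `|C|); first by rewrite ltr_pwDl.
apply: filterS (is_d2_near L_D2 (@ltr01 R)) => x [_ Lx].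
apply: norm_le_inner => [|z]; first by rewrite mulr_ge0 // addr_ge0.
rewrite -diff_lagrangianE //; have := Lx z; rewrite dL0 subr0 mul1r => le.
apply: le_trans (ler_norm _) _.
rewrite -[X in `|X|](subrK (d2 L xs (x - xs) z)) !mulrDl mul1r.
apply: le_trans (ler_normD _ _) _; apply: lerD => //.
apply: le_trans (BC _ _) _; rewrite -!mulrA; apply: ler_wpM2r; last exact: ler_norm.
by rewrite mulr_ge0.
Qed.

(** All components squared in [eta] are of order [|x - xs|]: the gradient of the Lagrangian is, and
    so is [g i x ^+ 2 * us 0 i], as [g i] vanishes at [xs] if active and [us 0 i = 0] otherwise. *)
Lemma eta_near : exists2 K : R, 0 < K &
  \forall x \near xs, eta f F g x ls us <= K * `|x - xs| ^+ 2.
Proof.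
have [K K0 LK] := grad_lagrangian_near.
have [C C0 FC] := diff_bounded (dF xs).
have /choice[G GP] : forall i, exists Gi, 0 < Gi /\
    \forall x \near xs, `|g i x - g i xs| <= Gi * `|x - xs|.
  by move=> i; have [Gi ? ?] := diff_lipschitz_near (dg i xs); exists Gi.
(* The second term bounds [g i x ^+ 2 * us 0 i], which is quadratic in [|x - xs|], by a linear one,
   using [|x - xs| <= 1]. *)
pose Ki i := (1 + `|grad (g i) xs|) * K + G i ^+ 2 * us 0 i.
have Ki0 i : 0 <= Ki i.
  have [_ ui] := kkt_sign i.
  apply: addr_ge0; apply: mulr_ge0 => //; first exact: ltW.
  exact: sqr_ge0.
exists (2^-1 * ((1 + C) * K) ^+ 2 + 2^-1 * \sum_i Ki i ^+ 2).
  rewrite ltr_wpDr //; first by rewrite mulr_ge0 // sumr_ge0 // => i _; exact: sqr_ge0.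
  by rewrite mulr_gt0 // exprn_gt0 // mulr_gt0 // addr_gt0.
have [_ Fe] := F_C1.
have Fn := Fe xs 1 ltr01.
have gn : \forall x \near xs, forall i, `|grad (g i) x - grad (g i) xs| <= 1.
  by apply: filter_forall => i; exact: (grad_near xs (g_C1 i) ltr01).
have Gn : \forall x \near xs, forall i, `|g i x - g i xs| <= G i * `|x - xs|.
  by apply: filter_forall => i; case: (GP i).
have x1 : \forall x \near xs, `|x - xs| <= 1.
  have /cvgrPdist_le/(_ 1 ltr01) : (x : X) @[x --> xs] --> xs by exact: cvg_id.
  by apply: filterS => x; rewrite distrC.
near=> x; have Lx : `|grad_lagrangian f F g x ls us| <= K * `|x - xs| by near: x.
have Fx h : `|'d F x h - 'd F xs h| <= 1 * `|h| by move: h; near: x.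
have gx i : `|grad (g i) x - grad (g i) xs| <= 1 by move: i; near: x.
have Gx i : `|g i x - g i xs| <= G i * `|x - xs| by move: i; near: x.
have x1' : `|x - xs| <= 1 by near: x.
move: Lx; rewrite /eta; move: (grad_lagrangian f F g x ls us) => V Vx.
have V0 : 0 <= K * `|x - xs| by rewrite mulr_ge0 // ltW.
rewrite mulrDl -!(mulrA 2^-1) mulr_suml -exprMn; apply: lerD; rewrite ler_pM2l //.
  rewrite ler_sqr ?nnegrE // -?mulrA ?mulr_ge0 ?addr_ge0 ?(ltW C0) //; last exact: ltW.
  rewrite -(subrK ('d F xs V) ('d F x V)).
  apply: le_trans (ler_normD _ _) _; apply: (@le_trans _ _ ((1 + C) * `|V|)).
    by rewrite mulrDl; apply: lerD.
  by rewrite ler_pM2l // addr_gt0.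
apply: ler_sum => i _; rewrite -exprMn -[X in X <= _]real_normK ?num_real //.
rewrite ler_sqr ?nnegrE ?mulr_ge0 //.
apply: le_trans (ler_normD _ _) _; rewrite /Ki mulrDl; apply: lerD.
  apply: le_trans (cauchy_schwarz _ _) _; rewrite -mulrA; apply: ler_pM => //.
  rewrite -(subrK (grad (g i) xs) (grad (g i) x)).
  by apply: le_trans (ler_normD _ _) _; rewrite lerD2r.
have [_ ui] := kkt_sign i; rewrite normrM normrX (ger0_norm ui).
have [g0|/kkt_inactive ->] := eqVneq (g i xs) 0; last by rewrite !mulr0 mul0r.
rewrite [X in _ <= X]mulrAC; apply: ler_wpM2r => //.
have := Gx i; rewrite g0 subr0 => le.
have Gi0 : 0 < G i by case: (GP i).
apply: (@le_trans _ _ ((G i * `|x - xs|) ^+ 2)).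
  by rewrite ler_sqr ?nnegrE // mulr_ge0 // ltW.
by rewrite exprMn ler_pM2l ?exprn_gt0 // expr2 ler_piMl.
Unshelve. all: by end_near. Qed.

Let P : pred 'I_m := fun i => g i xs == 0.
Let N := constraint_sqnorm ('d F xs) (fun i => grad (g i) xs) P.

(** [F] and the active [g i] vanish at [xs], so their values at [x] differ from the linearised ones
    by [o(|x - xs|)]. *)
Lemma constraint_sqnorm_near (e : R) : 0 < e -> \forall x \near xs,
  N (x - xs) <= 2 * (`|F x| ^+ 2 + \sum_(i | P i) g i x ^+ 2) + e * `|x - xs| ^+ 2.
Proof.
move=> e0; have m0 : 0 < 1 + m%:R :> R by rewrite ltr_pwDl.
pose e' := Num.min 1 (e / (2 * (1 + m%:R))).
have e'0 : 0 < e' by rewrite lt_min ltr01 divr_gt0 // mulr_gt0.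
have e'e : 2 * (1 + m%:R) * e' ^+ 2 <= e.
  apply: (@le_trans _ _ (2 * (1 + m%:R) * e')).
    by rewrite ler_pM2l ?mulr_gt0 // expr2 ler_piMr ?(ltW e'0) // ge_min lexx.
  by rewrite mulrC -ler_pdivlMr ?mulr_gt0 // ge_min lexx orbT.
have [_ F0 _] := kkt.
have gn : \forall x \near xs, forall i,
    `|g i x - g i xs - 'd (g i) xs (x - xs)| <= e' * `|x - xs|.
  by apply: filter_forall => i; exact: diff_near.
apply: filterS2 (diff_near (dF xs) e'0) gn => x Fx gx.
rewrite F0 subr0 distrC in Fx.
have s1 := norm_sq_perturb Fx.
have s2 : \sum_(i | P i) << grad (g i) xs, x - xs >> ^+ 2 <=
    2 * \sum_(i | P i) g i x ^+ 2 + m%:R * (2 * (e' * `|x - xs|) ^+ 2).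
  apply: (@le_trans _ _ (2 * \sum_(i | P i) g i x ^+ 2
      + \sum_(i | P i) 2 * (e' * `|x - xs|) ^+ 2)).
    rewrite mulr_sumr -big_split /=; apply: ler_sum => i /eqP g0.
    have := gx i; rewrite g0 subr0 distrC gradE // => /norm_sq_perturb.
    by rewrite !real_normK ?num_real.
  rewrite lerD2l (_ : m%:R * _ = \sum_(i < m) 2 * (e' * `|x - xs|) ^+ 2).
    rewrite big_mkcond /=; apply: ler_sum => i _; case: ifP => // _.
    by rewrite mulr_ge0 ?sqr_ge0.
  by rewrite sumr_const card_ord mulr_natl.
have s3 := ler_wpM2r (sqr_ge0 `|x - xs|) e'e.
rewrite /N /constraint_sqnorm; rewrite exprMn in s1 s2; lra.
Qed.

(** For multipliers supported on the active indices the terms [g i xs ^+ 2 * u i] vanish, so [Q] is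
    the squared norm of a bounded map applied to the adjoint vector, at most [D] times its squared
    norm. *)
Lemma constraint_adjoint_coercive : Q_positive_definite F g xs ->
  exists2 k : R, 0 < k & forall l (u : 'I_m -> R),
    k * (`|l| ^+ 2 + \sum_(i | P i) u i ^+ 2)
      <= `|adjoint ('d F xs) l + \sum_(i | P i) u i *: grad (g i) xs| ^+ 2.
Proof.
move=> [a a0 Qa]; have [C C0 FC] := diff_bounded (dF xs).
pose D := 2^-1 * C ^+ 2 + 2^-1 * \sum_i `|grad (g i) xs| ^+ 2.
have D0 : 0 < D.
  rewrite ltr_wpDr //; last by rewrite mulr_gt0 // exprn_gt0.
  by rewrite mulr_ge0 // sumr_ge0 // => i _; exact: sqr_ge0.
exists (a / D) => [|l u]; first exact: divr_gt0.
pose v : 'rV[R]_m := \row_i (if P i then u i else 0).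
have := Qa l v; rewrite QE.
have -> : sqn v = \sum_(i | P i) u i ^+ 2.
  rewrite /sqn /dotv [RHS]big_mkcond; apply: eq_bigr => i _; rewrite mxE.
  by case: ifP => _; rewrite ?mulr0 // expr2.
have -> : multiplier_grad F g xs l v =
    adjoint ('d F xs) l + \sum_(i | P i) u i *: grad (g i) xs.
  rewrite /multiplier_grad; congr (_ + _); rewrite [RHS]big_mkcond.
  by apply: eq_bigr => i _; rewrite mxE; case: ifP => // _; rewrite scale0r.
move: (adjoint _ _ + _) => V le; rewrite mulrAC ler_pdivrMr // [X in _ <= X]mulrC.
apply: le_trans le _; rewrite /D mulrDl -!(mulrA 2^-1) mulr_suml; apply: lerD.
  by rewrite ler_pM2l // -exprMn ler_sqr ?nnegrE ?mulr_ge0 // ltW.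
rewrite ler_pM2l //; apply: ler_sum => i _.
have -> : g i xs ^+ 2 * v 0 i = 0.
  rewrite mxE; case: ifP => [/eqP ->|_]; last by rewrite mulr0.
  by rewrite expr0n mul0r.
rewrite addr0 -exprMn -[X in X <= _]real_normK ?num_real // ler_sqr ?nnegrE ?mulr_ge0 //.
exact: cauchy_schwarz.
Qed.

End at_kkt_point.

(** * Lower bounds for the penalty terms *)

Section penalty_terms.
Context {R : realType}.

Lemma phi_lower_near (phi : R -> \bar R) (d : R) : phi_assumptions phi ->
  0 < d -> has_right_deriv0 phi d ->
  exists2 r : R, 0 < r & forall t : R, 0 <= t -> t < r ->
    d / 2 * t <= fine (phi t).
Proof.
move=> [_ [phi0 _ _]] d0 phid; have d2 : 0 < d / 2 by rewrite divr_gt0.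
move: phid; rewrite /has_right_deriv0 => /cvgrPdist_le /(_ _ d2) [r /= r0 rP].
have f0 : fine (phi 0) = 0 by rewrite ((phi0 0 (lexx 0)).2 erefl).
exists r => // t t0 tr.
have [->|t_neq0] := eqVneq t 0; first by rewrite mulr0 f0.
have tgt0 : 0 < t by rewrite lt0r t_neq0.
have := rP t; rewrite /= sub0r normrN gtr0_norm // => /(_ tr tgt0).
rewrite f0 subr0 ler_norml => /andP[_ le].
rewrite -ler_pdivlMr //; lra.
Qed.

(** The last hypothesis makes [mu y + k0 y^2] nondecreasing in [y >= gx], so [q] may be replaced by
    [gx]. Completing the square in [mu - mu0] costs [(4 s)^-1 gx^2], and [k0] still covers
    [D gx^2]. *)
Lemma shifted_max_lower (k k0 s D mu0 mu gx q z : R) :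
  0 < k0 -> k0 <= k -> 0 < s -> (4 * s)^-1 + D <= k0 -> 0 <= D ->
  q = Num.max gx z -> 0 <= mu + 2 * k0 * gx ->
  mu0 * gx - s * (mu - mu0) ^+ 2 + D * gx ^+ 2 <= mu * q + k * q ^+ 2.
Proof.
move=> k00 k0k s0 Dk D0 qE h.
have gq : gx <= q by rewrite qE le_max lexx.
have le1 : mu * gx + k0 * gx ^+ 2 <= mu * q + k0 * q ^+ 2.
  rewrite -subr_ge0 (_ : _ - _ =
    (q - gx) * ((mu + 2 * k0 * gx) + k0 * (q - gx))); last by ring.
  by rewrite mulr_ge0 ?subr_ge0 // addr_ge0 // mulr_ge0 ?subr_ge0 // ltW.
have le2 : k0 * q ^+ 2 <= k * q ^+ 2 by rewrite ler_wpM2r ?sqr_ge0.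
have le3 := ler_wpM2r (sqr_ge0 gx) Dk.
have le4 : 0 <= s * (mu - mu0) ^+ 2 + (mu - mu0) * gx + (4 * s)^-1 * gx ^+ 2.
  rewrite (_ : _ + _ = s * (mu - mu0 + (2 * s)^-1 * gx) ^+ 2).
    by rewrite mulr_ge0 ?sqr_ge0 // ltW.
  by field; rewrite lt0r_neq0.
lra.
Qed.

Lemma inactive_lower (k k0 s mu q : R) : 0 < k0 -> k0 <= k -> 0 < s ->
  (4 * s)^-1 <= k0 -> - (s * mu ^+ 2) <= mu * q + k * q ^+ 2.
Proof.
move=> k00 k0k s0 sk.
have le2 : (4 * s)^-1 * q ^+ 2 <= k * q ^+ 2.
  by rewrite ler_wpM2r ?sqr_ge0 // (le_trans sk).
have le4 : 0 <= s * mu ^+ 2 + mu * q + (4 * s)^-1 * q ^+ 2.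
  rewrite (_ : _ + _ = s * (mu + (2 * s)^-1 * q) ^+ 2).
    by rewrite mulr_ge0 ?sqr_ge0 // ltW.
  by field; rewrite lt0r_neq0.
lra.
Qed.

End penalty_terms.

Lemma sqn_ge0 {R : realType} m (u : 'rV[R]_m) : 0 <= sqn u.
Proof. by apply: sumr_ge0 => i _; rewrite -expr2 sqr_ge0. Qed.

Lemma sqn_eq0 {R : realType} m (u : 'rV[R]_m) : sqn u = 0 -> u = 0.
Proof.
move=> u0; apply/rowP => i; rewrite mxE; apply/eqP; rewrite -sqrf_eq0 expr2; apply/eqP.
by move: i (erefl true); apply: psumr_eq0P => // i _; rewrite -expr2 sqr_ge0.
Qed.

(** * Quadratic growth of the augmented Lagrangian *)

Section local_minimum.
Context {R : realType} {X H : hilbertType R} {m : nat}.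
Variables (f : X -> R) (F : X -> H) (g : 'I_m -> X -> R).
Variables (phi : R -> \bar R) (psi : 'rV[R]_m -> R).
Hypotheses (f_C1 : continuously_differentiable f)
  (F_C1 : continuously_differentiable F)
  (g_C1 : forall i, continuously_differentiable (g i)).
Hypotheses (phiP : phi_assumptions phi) (psiP : psi_assumptions psi).
Variables (xs : X) (ls : H) (us : 'rV[R]_m).
Hypotheses (kkt : kkt_point f F g xs ls us)
  (scompl : strict_complementarity g xs us).

(** The upper bound makes the coefficient [c / (2 p)] at least [c / (2 psi 0)], uniformly in [x] and
    [u]. *)
Lemma pfun_bounds x u : 0 < bfun g psi x ->
  0 < pfun g psi x u /\ pfun g psi x u <= psi 0.
Proof.
move=> b0; have u1 : 1 <= 1 + sqn u by rewrite lerDl sqn_ge0.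
have u0 : 0 < 1 + sqn u by apply: lt_le_trans u1.
split; first exact: divr_gt0.
rewrite /pfun ler_pdivrMr //; have [_ _ psi0 psi_max _] := psiP.
apply: (@le_trans _ _ (psi 0)); last by rewrite ler_peMr // ltW.
by apply: psi_max => i; rewrite !mxE le_max lexx orbT.
Qed.

(** Here [q = 0]: for an active index the second entry of the maximum is nonpositive, for an
    inactive one it is 0. Also [eta = 0], by stationarity and complementarity. *)
Lemma aug_lagrangian_kkt c : 0 < c ->
  aug_lagrangian f F g phi psi xs ls us c = (f xs)%:E.
Proof.
move=> c0; have [L0 F0 _] := kkt; have [_ [phi0 _ _]] := phiP.
have [_ _ psi0 _ _] := psiP.
have phi00 : phi 0 = 0%E by apply/phi0.
have b0 : 0 < bfun g psi xs.
  rewrite /bfun (_ : maxv _ _ = 0) //; apply/rowP => i; rewrite !mxE.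
  by apply/max_idPr; case: (kkt_sign kkt i).
have [p0 _] := pfun_bounds us b0.
rewrite /aug_lagrangian F0 normr0 expr0n /= phi00 asboolT; last first.
  by split=> //=; rewrite F0 normr0 expr0n /= phi00 ltry.
rewrite (_ : maxv _ _ = 0); last first.
  apply/rowP => i; rewrite !mxE; have [gi ui] := kkt_sign kkt i.
  have [g0|g0] := eqVneq (g i xs) 0.
    rewrite g0; apply/max_idPl; rewrite mulNr oppr_le0 mulr_ge0 // mulr_ge0 ?invr_ge0 //; exact: ltW.
  by rewrite (kkt_inactive kkt g0) mulr0; exact/max_idPr.
rewrite /sqn /dotv big1 ?big1 => [|i _|i _]; rewrite ?mxE ?mulr0 //.
rewrite /eta L0 (linear0 ('d F xs)) normr0 big1 => [|i _]; last first.
  rewrite inner0r add0r.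
  by rewrite [g i xs ^+ 2]expr2 -mulrA (mulrC _ (us 0 i)) (kkt_complementarity kkt) mulr0 expr0n.
by rewrite inner0r expr0n /= !mulr0 !addr0 mule0 !adde0.
Qed.

Hypotheses (f_D2 : twice_differentiable f xs) (F_D2 : twice_differentiable F xs)
  (g_D2 : forall i, twice_differentiable (g i) xs).

(** The neighbourhood found here serves all [c >= cs] at once and restricts only [x] and [u]. *)
Lemma aug_lagrangian_growth :
  (exists2 d : R, 0 < d & has_right_deriv0 phi d) ->
  Q_positive_definite F g xs -> second_order_sufficient f F g xs ls us ->
  exists cs theta : R, [/\ 0 < cs, 0 < theta &
    \forall x \near xs & u \near us, forall l c, cs <= c ->
    ((f xs + theta * (`|x - xs| ^+ 2 + `|l - ls| ^+ 2 + sqn (u - us)))%:E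
       <= aug_lagrangian f F g phi psi x l u c)%E].
Proof.
move=> [d d0 phid] Qpd [rho rho0 sosc].
have [df _] := f_C1; have [dF _] := F_C1; have dg i := (g_C1 i).1.
pose L x := lagrangian f F g x ls us.
pose P : pred 'I_m := fun i => g i xs == 0.
pose N := constraint_sqnorm ('d F xs) (fun i => grad (g i) xs) P.
have [_ [Bl Br] [M BM] _] : is_d2 L xs (d2 L xs).
  by apply: d2P; exact: twice_differentiable_lagrangian.
have [C _ FC] := diff_bounded (dF xs).
have [k k0 kP] := constraint_adjoint_coercive F_C1 Qpd.
have [|D D0 DP] := positive_definite_penalized (diff_continuous (dF xs)) FC k0 kP Bl Br BM rho0.
  move=> z Fz gz; apply: sosc => // i /eqP gi; exact: gz.
have [a1 a10 Qn] := Q_coercive_near F_C1 g_C1 Qpd.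
have [K K0 Kn] := eta_near f_C1 F_C1 g_C1 kkt f_D2 F_D2 g_D2.
have [r r0 rP] := phi_lower_near phiP d0 phid.
(* Chosen so that the loss [t * eta] at the fixed multipliers is at most [rho / 32 * |x - xs|^2]. *)
pose t := rho / (32 * K); have t0 : 0 < t by rewrite divr_gt0 // mulr_gt0.
pose a2 := t / (1 + t) * a1.
have a20 : 0 < a2 by rewrite mulr_gt0 // divr_gt0 // addr_gt0.
(* [eta] gains [2 s] times the squared multiplier distance. The penalty estimates spend one [s], and
   the other is left for [theta]. *)
pose s := a2 / 2; have s0 : 0 < s by rewrite divr_gt0.
(* The penalty weight required: [(4 s)^-1] to complete squares and [D] to pay for the constraint
   norm in the Hessian bound. *)
pose Z := (4 * s)^-1 + D; have Z0 : 0 < Z by rewrite addr_gt0 // invr_gt0 mulr_gt0.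
have [_ _ psi0 _ _] := psiP.
(* The first entry gives weight [Z] to the inequality constraints through [c / (2 p)], the second to
   [F] through [c / 2 * (d / 2)]. *)
pose cs := Num.max (2 * psi 0 * Z) (4 * Z / d).
have cs1 : 2 * psi 0 * Z <= cs by rewrite le_max lexx.
have cs2 : 4 * Z / d <= cs by rewrite le_max lexx orbT.
have cs0 : 0 < cs by apply: lt_le_trans cs1; rewrite !mulr_gt0.
pose k1 := cs / (2 * psi 0).
have k1Z : Z <= k1 by rewrite ler_pdivlMr ?mulr_gt0 // mulrC.
have k10 : 0 < k1 by apply: lt_le_trans k1Z.
exists cs, (Num.min (rho / 32) s); split=> //.
  by rewrite lt_min s0 andbT divr_gt0.
have e1 : 0 < rho / 32 by rewrite divr_gt0.
have e2 : 0 < rho / (16 * D) by rewrite divr_gt0 // mulr_gt0.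
have Ln := lagrangian_taylor f_C1 F_C1 g_C1 kkt f_D2 F_D2 g_D2 e1.
have Nn := constraint_sqnorm_near F_C1 g_C1 kkt e2.
have Fn : \forall x \near xs, `|F x| ^+ 2 < r.
  have Fc : F x @[x --> xs] --> F xs by exact: differentiable_continuous.
  have Fc2 : `|F x| ^+ 2 @[x --> xs] --> `|F xs| ^+ 2.
    by apply: cvgM; exact: cvg_norm.
  move: Fc2; have [_ -> _] := kkt; rewrite normr0 expr0n /= => /cvgr_lt; exact.
(* With [|g i x| <= z i] and [u 0 i >= us 0 i / 2], the sign condition of [shifted_max_lower] holds
   for active [i]; strict complementarity makes the radius positive. The 1 is a placeholder. *)
pose z i : R := if P i then us 0 i / (4 * k1) else 1.
have z0 i : 0 < z i.
  by rewrite /z; case: ifP => // /eqP gi; apply: divr_gt0; [exact: scompl|exact: mulr_gt0].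
have gn : \forall x \near xs, forall i, P i -> `|g i x| <= z i.
  apply: filter_forall => i; case: (boolP (P i)) => [/eqP gi|_]; last exact: nearW.
  have /cvgrPdist_le/(_ _ (z0 i)) : g i x @[x --> xs] --> g i xs.
    exact: differentiable_continuous.
  by apply: filterS => x; rewrite gi sub0r normrN.
have unear : \forall u \near us, forall i, P i -> us 0 i / 2 <= (u : 'rV[R]_m) 0 i.
  have usF : Filter (nbhs us) by exact: nbhs_filter.
  apply: (@filter_forall _ _ (fun i (u : 'rV[R]_m) => P i -> us 0 i / 2 <= u 0 i) _ usF).
  move=> i.
  case: (boolP (P i)) => [/eqP gi|_]; last exact: nearW.
  have uc : {for us, continuous (fun u : 'rV[R]_m => u 0 i)} by exact: coord_continuous.
  have : us 0 i / 2 < us 0 i.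
    rewrite gtr_pMr; [by rewrite invf_lt1 // ltr1n|exact: scompl].
  by move=> /(cvgr_gt _ uc); apply: filterS => u /ltW.
near=> x u; move=> l c csc.
have un i : P i -> us 0 i / 2 <= u 0 i by move: i; near: u.
have c0 : 0 < c by apply: lt_le_trans csc.
rewrite /aug_lagrangian; case: asboolP => [[b0 phix]|_]; last by rewrite leey.
have [p0 ppsi] := pfun_bounds u b0.
set p := pfun g psi x u in p0 ppsi *; set q := maxv _ _.
have [[phi_ge0 _ _ _] _] := phiP.
have phiE : phi (`|F x| ^+ 2) = (fine (phi (`|F x| ^+ 2)))%:E.
  by rewrite fineK // ge0_fin_numE // phi_ge0 // sqr_ge0.
have ph : d / 2 * `|F x| ^+ 2 <= fine (phi (`|F x| ^+ 2)).
  by apply: rP; [exact: sqr_ge0|near: x].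
rewrite phiE -EFinM -!EFinD lee_fin; move: ph; move: (fine _) => y ph {phiE phix}.
have kk : k1 <= c / (2 * p).
  have pp : 2 * p <= 2 * psi 0 by rewrite ler_pM2l.
  apply: ler_pM => //; [exact: ltW|by rewrite invr_ge0 mulr_ge0 // ltW|].
  by rewrite lef_pV2 // posrE mulr_gt0.
have qsum : dotv us (gvec g x) - s * sqn (u - us) + D * \sum_(i | P i) g i x ^+ 2
    <= dotv u q + c / (2 * p) * sqn q.
  rewrite /sqn /dotv !mulr_sumr -sumrB -big_split /= [X in _ + X]big_mkcond -big_split /=.
  apply: ler_sum => i _; rewrite -expr2 [(u - us) 0 i]mxE [(- us) 0 i]mxE -expr2 [gvec g x 0 i]mxE.
  case: ifP => Pi.
    have lemq : q 0 i = Num.max (g i x) ((- (c^-1 * p) *: u) 0 i) by rewrite !mxE.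
    have le0 := shifted_max_lower (us 0 i) k10 kk s0 k1Z (ltW D0) lemq.
    apply: le0 => {lemq}.
    have gx : `|g i x| <= z i by move: i Pi; near: x.
    move: gx; rewrite /z Pi ler_norml => /andP[gx _]; have := un i Pi.
    have k12 : 0 <= 2 * k1 by rewrite mulr_ge0 // ltW.
    have := ler_wpM2l k12 gx.
    rewrite (_ : 2 * k1 * _ = - (us 0 i / 2)); last by field; rewrite lt0r_neq0.
    lra.
  have -> : us 0 i = 0 by apply: (kkt_inactive kkt); rewrite -/(P i) Pi.
  rewrite mul0r add0r subr0 addr0; apply: (inactive_lower _ _ k10 kk s0).
  by apply: le_trans k1Z; rewrite lerDl ltW.
have Fpart : << ls, F x >> - s * `|l - ls| ^+ 2 + D * `|F x| ^+ 2 <=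
    << l, F x >> + c / 2 * (1 + `|l| ^+ 2) * y.
  have y0 : 0 <= y by apply: le_trans ph; rewrite mulr_ge0 ?sqr_ge0 // divr_ge0 // ltW.
  have le1 : Z * `|F x| ^+ 2 <= c / 2 * (1 + `|l| ^+ 2) * y.
    apply: (@le_trans _ _ (cs / 2 * (d / 2 * `|F x| ^+ 2))).
      rewrite (_ : cs / 2 * _ = cs * d / 4 * `|F x| ^+ 2); last by field.
      by rewrite ler_wpM2r ?sqr_ge0 // ler_pdivlMr // mulrC -ler_pdivrMr.
    apply: ler_pM => //; rewrite ?divr_ge0 ?mulr_ge0 ?sqr_ge0 ?(ltW cs0) ?(ltW d0) //.
    rewrite -[X in X <= _]mulr1; apply: ler_pM => //; rewrite ?divr_ge0 ?(ltW cs0) //.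
      by rewrite ler_pM2r.
    by rewrite lerDl sqr_ge0.
  have := cauchy_schwarz (l - ls) (F x); rewrite ler_norml => /andP[le3 _].
  have le4 : `|l - ls| * `|F x| <= s * `|l - ls| ^+ 2 + (4 * s)^-1 * `|F x| ^+ 2.
    rewrite -subr_ge0 (_ : _ - _ = s * (`|l - ls| - (2 * s)^-1 * `|F x|) ^+ 2).
      by rewrite mulr_ge0 ?sqr_ge0 // ltW.
    by field; rewrite lt0r_neq0.
  move: le3; rewrite innerDl innerNl.
  move: le1 le4; rewrite /Z mulrDl.
  lra.
have etap := eta_lower l ls u us (df x) (dF x) (fun i => dg i x) t0.
have Qx : a1 * (`|l - ls| ^+ 2 + sqn (u - us)) <= Q F g x (l - ls) (u - us).
  by move: (l - ls) (u - us); near: x.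
have Lx : f xs + 2^-1 * d2 L xs (x - xs) (x - xs) - rho / 32 * `|x - xs| ^+ 2
  <= L x by near: x.
have Nx : N (x - xs) <= 2 * (`|F x| ^+ 2 + \sum_(i | P i) g i x ^+ 2)
  + rho / (16 * D) * `|x - xs| ^+ 2 by near: x.
have etax : eta f F g x ls us <= K * `|x - xs| ^+ 2 by near: x.
have Bx := DP (x - xs).
have le1 : a2 * (`|l - ls| ^+ 2 + sqn (u - us)) <=
    t / (1 + t) * Q F g x (l - ls) (u - us).
  rewrite /a2 -mulrA ler_pM2l // divr_gt0 // addr_gt0 //.
have le2 : t * eta f F g x ls us <= rho / 32 * `|x - xs| ^+ 2.
  rewrite (_ : rho / 32 = t * K); last by rewrite /t; field; rewrite lt0r_neq0.
  by rewrite -mulrA ler_pM2l.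
have le3 : D * N (x - xs) <= 2 * D * (`|F x| ^+ 2 + \sum_(i | P i) g i x ^+ 2)
    + rho / 16 * `|x - xs| ^+ 2.
  apply: (le_trans (ler_wpM2l (ltW D0) Nx)); rewrite le_eqVlt; apply/orP; left.
  by apply/eqP; field; rewrite lt0r_neq0.
have le4 : Num.min (rho / 32) s * (`|x - xs| ^+ 2 + `|l - ls| ^+ 2 + sqn (u - us)) <=
    rho / 32 * `|x - xs| ^+ 2 + s * (`|l - ls| ^+ 2 + sqn (u - us)).
  rewrite -addrA mulrDr; apply: lerD; apply: ler_wpM2r.
  - exact: sqr_ge0.
  - by rewrite ge_min lexx.
  - by rewrite addr_ge0 ?sqr_ge0 ?sqn_ge0.
  - by rewrite ge_min lexx orbT.
have a2s : a2 = 2 * s by rewrite /s; field.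
rewrite {}a2s in le1; have {}Bx : rho / 4 * `|x - xs| ^+ 2 - D * N (x - xs)
  <= d2 L xs (x - xs) (x - xs) := Bx.
(* In units of [|x - xs|^2], half of the Hessian bound gives [rho / 8]. Taylor's remainder, the
   linearisation of the constraints and [eta] each take [rho / 32], so [rho / 32] remains. *)
move: qsum Fpart etap Lx le1 le2 le3 le4 Bx; rewrite /L /lagrangian.
clear; lra.
Unshelve. all: by end_near. Qed.
End local_minimum.

(** * From quadratic growth to strict local minimality *)

Theorem theorem5p8 (R : realType) (X H : hilbertType R) (m : nat)
    (f : X -> R) (F : X -> H) (g : 'I_m -> X -> R)
    (phi : R -> \bar R) (psi : 'rV[R]_m -> R)
    (f_C1 : continuously_differentiable f)
    (F_C1 : continuously_differentiable F)
    (g_C1 : forall i, continuously_differentiable (g i))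
    (solvable : exists x, global_solution f F g x)
    (phiP : phi_assumptions phi)
    (psiP : psi_assumptions psi)
    (xs : X) (ls : H) (us : 'rV[R]_m)
    (kkt : kkt_point f F g xs ls us)
    (scompl : strict_complementarity g xs us)
    (f_D2 : twice_differentiable f xs)
    (F_D2 : twice_differentiable F xs)
    (g_D2 : forall i, twice_differentiable (g i) xs)
    (phi_diff0 : exists2 d : R, 0 < d & has_right_deriv0 phi d)
    (Q_pd : Q_positive_definite F g xs)
    (sosc : second_order_sufficient f F g xs ls us) :
  exists cs theta : R, [/\ 0 < cs, 0 < theta &
    forall c : R, cs <= c ->
      strict_local_min
        (fun w : X * H * 'rV[R]_m =>
           aug_lagrangian f F g phi psi w.1.1 w.1.2 w.2 c) (xs, ls, us) /\
      nbhs (xs, ls, us) (fun w : X * H * 'rV[R]_m =>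
        (aug_lagrangian f F g phi psi xs ls us c
           + (theta * (`|w.1.1 - xs| ^+ 2 + `|w.1.2 - ls| ^+ 2
                       + sqn (w.2 - us)))%:E
         <= aug_lagrangian f F g phi psi w.1.1 w.1.2 w.2 c)%E)].
Proof.
have [cs [theta [cs0 theta0 growth]]] := aug_lagrangian_growth f_C1 F_C1 g_C1
  phiP psiP kkt scompl f_D2 F_D2 g_D2 phi_diff0 Q_pd sosc.
exists cs, theta; split=> // c csc.
have near_growth : nbhs (xs, ls, us) (fun w : X * H * 'rV[R]_m =>
    ((f xs + theta * (`|w.1.1 - xs| ^+ 2 + `|w.1.2 - ls| ^+ 2
                       + sqn (w.2 - us)))%:E
       <= aug_lagrangian f F g phi psi w.1.1 w.1.2 w.2 c)%E).
  (* The neighbourhood in [x] and [u] is extended by the whole space [H] in the middle factor. *)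
  have [[A B] /= [nA nB] AB] := growth.
  exists ([set v | A v.1], B) => /=; first by split=> //; exists (A, setT) => [|v []];
    [split=> //; exact: filterT|].
  by move=> [[x l] u] /= [Ax Bu]; exact: (AB (x, u)).
have base := aug_lagrangian_kkt phiP psiP kkt (lt_le_trans cs0 csc).
rewrite /strict_local_min base; split; apply: filterS near_growth => -[[x l] u] /=.
  (* Strictness holds because the sum of the three squared distances vanishes only at the reference
     triplet. *)
  move=> le neq; apply: lt_le_trans le; rewrite lte_fin ltrDl mulr_gt0 //.
  have S0 : 0 <= `|x - xs| ^+ 2 + `|l - ls| ^+ 2 by rewrite addr_ge0 ?sqr_ge0.
  rewrite lt0r addr_ge0 ?sqn_ge0 // andbT; apply: contra_not_neq neq => /eqP.
  rewrite paddr_eq0 ?sqn_ge0 // paddr_eq0 ?sqr_ge0 // !sqrf_eq0 !normr_eq0 !subr_eq0.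
  by move=> /andP[/andP[/eqP -> /eqP ->]] /eqP /sqn_eq0 /eqP; rewrite subr_eq0 => /eqP ->.
by [].
Qed.
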